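(* Let $\rho:(0,\infty)\to(0,\infty)$ be a positive function with $\rho(x)\to 0$ as $x\to\infty$. (i) There is a non-decreasing function $S:[0,\infty)\to\mathbb{R}$ whose Laplace-Stieltjes transform $\mathcal{L}\{\mathrm{d}S;s\}=\int_{0}^{\infty}e^{-sx}\,\mathrm{d}S(x)$ converges for $\operatorname{Re} s>1$ and is such that $$\mathcal{L}\{\mathrm{d}S;s\}-\frac{1}{s-1}$$ extends to the whole complex plane $\mathbb{C}$ as an entire function, but which satisfies the oscillation estimate $$S(x)=e^{x}+\Omega_{\pm}(\rho(x)e^{x}).$$ (ii) There is a smooth ($C^\infty$) function $\tau:(0,\infty)\to\mathbb{R}$ with bounded derivative whose Laplace transform $\mathcal{L}\{\tau;s\}=\int_{0}^{\infty}\tau(x)e^{-sx}\,\mathrm{d}x$ can be analytically continued to the whole of $\mathbb{C}$, but which satisfies the oscillation estimate $$\tau(x)=\Omega_{\pm}(\rho(x)).$$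
   Context: For a real-valued function $f$ and a positive function $g$, the notation $f(x)=\Omega_{\pm}(g(x))$ means that there is a constant $c>0$ such that each of the inequalities $f(x)>c\,g(x)$ and $f(x)<-c\,g(x)$ holds for arbitrarily large values of $x$. The notation $S(x)=e^{x}+\Omega_{\pm}(g(x))$ means $S(x)-e^{x}=\Omega_{\pm}(g(x))$. *)

(* Defs.v *)
From Stdlib Require Export Reals.
From Coquelicot Require Export Coquelicot.
Open Scope R_scope.

(** Riemann-Stieltjes integral of a vector-valued [f] against [dg], obtained
    from [Riemann_sum], [is_RInt] and [is_RInt_gen] by replacing the length
    [y - x] of a subdivision interval with [g y - g x] (see [is_RSInt_id]).
    A jump of [g] at the endpoint [a] or [b] is thus counted as
    [g (a+) - g a], resp. [g b - g (b-)]. *)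

Definition RS_sum {V : ModuleSpace R_Ring} (f : R -> V) (g : R -> R)
    (ptd : SF_seq) : V :=
  seq.foldr plus zero
    (seq.pairmap (fun x y => scal (g (fst y) - g (fst x)) (f (snd y)))
       (SF_h ptd, zero) (SF_t ptd)).

Definition is_RSInt {V : NormedModule R_AbsRing} (f : R -> V) (g : R -> R)
    (a b : R) (l : V) : Prop :=
  filterlim (fun ptd => scal (sign (b - a)) (RS_sum f g ptd))
    (Riemann_fine a b) (locally l).

Definition is_RSInt_gen {V : NormedModule R_AbsRing} (f : R -> V) (g : R -> R)
    (Fa Fb : (R -> Prop) -> Prop) (l : V) : Prop :=
  filterlimi (fun ab => is_RSInt f g (fst ab) (snd ab))
    (filter_prod Fa Fb) (locally l).

Lemma is_RSInt_id {V : NormedModule R_AbsRing} (f : R -> V) (a b : R) (l : V) :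
  is_RSInt f (fun x => x) a b l <-> is_RInt f a b l.
Proof. reflexivity. Qed.

Definition Cexp (z : C) : C :=
  (exp (Re z) * cos (Im z), exp (Re z) * sin (Im z)).

(** Absolute convergence is not required in either transform: the value
    [l] is the limit of the integrals over [[0, T]], resp. [[e, T]], as
    [T] tends to infinity and [e] to [0+]. *)

Definition is_Laplace_Stieltjes (S : R -> R) (s l : C) : Prop :=
  is_RSInt_gen (V := C_R_NormedModule)
    (fun x => Cexp (- (s * RtoC x))%C) S
    (at_point 0) (Rbar_locally p_infty) l.

Definition is_Laplace (f : R -> R) (s l : C) : Prop :=
  is_RInt_gen (V := C_R_NormedModule)
    (fun x => (RtoC (f x) * Cexp (- (s * RtoC x)))%C)
    (at_right 0) (Rbar_locally p_infty) l.

Definition entire (G : C -> C) : Prop :=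
  forall z : C, ex_derive (K := C_AbsRing) (V := C_NormedModule) G z.

Definition extends_entire (D : C -> Prop) (F : C -> C) : Prop :=
  exists G : C -> C, entire G /\ forall s : C, D s -> G s = F s.

Definition Omega_pm (f g : R -> R) : Prop :=
  exists c : R, 0 < c /\
    (forall X : R, exists x : R, X < x /\ f x > c * g x) /\
    (forall X : R, exists x : R, X < x /\ f x < - (c * g x)).

(* Main.v *)
(** The function [tau] is a sum of bumps with disjoint supports [[k_n, 2 k_n]],
    the n-th one being (-1)^n 4^(-n) sin^(k_n)(pi (x - k_n) / k_n) cos(2^n (x - 3 k_n / 2)),
    smoothed at the two ends of its support.  The integers [k_n] grow so fast
    that [rho <= 4^(-n) / 2] from [k_n] on, so the centres of the bumps give the
    oscillation, while [4^(-n) 2^n] is summable, so the derivative is bounded.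
    Since all derivatives of sin^k(pi x / k) are of size O(1)^j, integrating by
    parts [k_n] times bounds the Laplace transform of the n-th bump by
    (C / 2^n)^(k_n) e^(2 |s| k_n), which is summable locally uniformly in [s].
    For part (i), S(x) = e^x (1 + eta tau(x)) with [eta] small enough that
    [S' >= 0], and then L{dS; s} = 1 / (s - 1) + eta s L{tau; s - 1}. *)

Require Import Defs.
From Stdlib Require Import ssreflect Lra Lia Psatz IndefiniteDescription.

(** The exponent of the sine, the length of the support and the number of integrations by parts are
    one and the same integer [k_n]. The degree times the frequency pi / k_n therefore stays bounded,
    and the loss e^(2 |s| k_n) due to the position of the bump carries the same exponent as the gain
    (C / 2^n)^(k_n). Only 2^n has to outgrow a constant depending on s, however fast [k_n] grows;
    the finitely many bumps for which it does not yet do so are bounded trivially. The smoothing is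
    needed because sin^k vanishes only to finite order at the ends. It is never integrated by parts:
    the transforms with and without it differ by a sup norm estimate, made small through the free
    parameter [d]. To sum the transforms as holomorphic functions, the second-order Taylor remainder
    in s of each one must be bounded too. It is the same integral with another weight, which is why
    the oscillation estimate carries a weight together with all its derivatives. *)

Notation CR := C_R_CompleteNormedModule.
Notation CInt := (RInt (V := CR)).
Notation is_CInt := (is_RInt (V := CR)).
Notation ex_CInt := (ex_RInt (V := CR)).
Notation is_Cder := (is_derive (K := R_AbsRing) (V := C_R_NormedModule)).

(** * Complex-valued functions of a real variable *)

Lemma Cder_pair (f g : R -> R) (x f' g' : R) :
  is_derive f x f' -> is_derive g x g' ->
  is_Cder (fun t => (f t, g t)) x (f', g').
Proof.
intros Hf Hg.
pose proof (is_derive_scal_l (V := C_R_NormedModule) f x f' ((1, 0) : C) Hf) as H1.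
pose proof (is_derive_scal_l (V := C_R_NormedModule) g x g' ((0, 1) : C) Hg) as H2.
pose proof (is_derive_plus _ _ _ _ _ H1 H2) as H.
replace ((f', g') : C_R_NormedModule) with
  (plus (scal f' ((1, 0) : C_R_NormedModule)) (scal g' ((0, 1) : C_R_NormedModule))).
- apply (is_derive_ext _ _ _ _ ) with (2 := H).
  intros t; apply injective_projections; simpl;
  unfold plus, scal; simpl; unfold mult; simpl; ring.
- apply injective_projections; simpl; unfold plus, scal; simpl; unfold mult; simpl; ring.
Qed.

Lemma Cder_Re (f : R -> C) (x : R) (l : C) :
  is_Cder f x l -> is_derive (fun t => Re (f t)) x (Re l).
Proof.
intros H.
apply (filterdiff_comp' f (fst : C_R_NormedModule -> R_NormedModule)
   x (fun y => scal y l) fst H).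
apply filterdiff_linear, is_linear_fst.
Qed.

Lemma Cder_Im (f : R -> C) (x : R) (l : C) :
  is_Cder f x l -> is_derive (fun t => Im (f t)) x (Im l).
Proof.
intros H.
apply (filterdiff_comp' f (snd : C_R_NormedModule -> R_NormedModule)
   x (fun y => scal y l) snd H).
apply filterdiff_linear, is_linear_snd.
Qed.

Lemma Cder_eq (f : R -> C) (x : R) (l l' : C) : is_Cder f x l -> l = l' -> is_Cder f x l'.
Proof. now intros H <-. Qed.

(** C is a normed module over R here, so a complex factor is not a scalar; products are handled
    through real and imaginary parts, here and in the continuity and integration lemmas below. *)
Lemma Cder_mult (f g : R -> C) (x : R) (f' g' : C) :
  is_Cder f x f' -> is_Cder g x g' ->
  is_Cder (fun t => (f t * g t)%C) x (f' * g x + f x * g')%C.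
Proof.
intros Hf Hg.
pose proof (Cder_Re _ _ _ Hf) as F1; pose proof (Cder_Im _ _ _ Hf) as F2.
pose proof (Cder_Re _ _ _ Hg) as G1; pose proof (Cder_Im _ _ _ Hg) as G2.
eapply Cder_eq.
- apply (Cder_pair (fun t => Re (f t) * Re (g t) - Im (f t) * Im (g t))
                   (fun t => Re (f t) * Im (g t) + Im (f t) * Re (g t))).
  + apply: is_derive_minus; apply: is_derive_mult; eauto; intros; apply Rmult_comm.
  + apply: is_derive_plus; apply: is_derive_mult; eauto; intros; apply Rmult_comm.
- apply injective_projections; simpl; unfold plus, minus, opp, mult, Re, Im; simpl;
  unfold plus, opp; simpl; ring.
Qed.

Lemma Ccont_pair (f g : R -> R) (x : R) :
  continuous f x -> continuous g x -> continuous (U := CR) (fun t => (f t, g t)) x.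
Proof.
intros Hf Hg.
apply (continuous_comp_2 f g (fun u v => (u, v) : CR)); trivial.
apply (continuous_ext (fun z => z)); [now intros [u v] | apply: continuous_id].
Qed.

Lemma Ccont_mult (f g : R -> C) (x : R) :
  continuous (U := CR) f x -> continuous (U := CR) g x ->
  continuous (U := CR) (fun t => (f t * g t)%C) x.
Proof.
intros Hf Hg.
assert (F1 : continuous (fun t => fst (f t)) x).
{ apply (continuous_comp f (fst : CR -> R)); trivial; apply: continuous_fst. }
assert (F2 : continuous (fun t => snd (f t)) x).
{ apply (continuous_comp f (snd : CR -> R)); trivial; apply: continuous_snd. }
assert (G1 : continuous (fun t => fst (g t)) x).
{ apply (continuous_comp g (fst : CR -> R)); trivial; apply: continuous_fst. }
assert (G2 : continuous (fun t => snd (g t)) x).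
{ apply (continuous_comp g (snd : CR -> R)); trivial; apply: continuous_snd. }
apply Ccont_pair; [apply: continuous_minus | apply: continuous_plus];
apply: continuous_mult; assumption.
Qed.

Lemma CInt_Cmult (f : R -> C) (a b : R) (c l : C) :
  is_CInt f a b l -> is_CInt (fun x => (c * f x)%C) a b (c * l)%C.
Proof.
intros H.
pose proof (is_RInt_fct_extend_fst _ _ _ _ H) as H1.
pose proof (is_RInt_fct_extend_snd _ _ _ _ H) as H2.
apply (is_RInt_fct_extend_pair (U := R_NormedModule) (V := R_NormedModule)); simpl.
- apply: is_RInt_minus; apply: is_RInt_scal; assumption.
- apply: is_RInt_plus; apply: is_RInt_scal; assumption.
Qed.

Lemma norm_CR (z : C) : norm (z : C_R_NormedModule) = Cmod z.
Proof.
unfold norm; simpl; unfold prod_norm, Cmod; do 2 f_equal; apply pow2_abs.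
Qed.

Lemma CInt_norm_le (f : R -> C) (a b M : R) :
  a <= b -> ex_CInt f a b -> (forall x, a <= x <= b -> Cmod (f x) <= M) ->
  Cmod (CInt f a b) <= M * (b - a).
Proof.
intros Hab Hf HM.
replace (M * (b - a)) with ((b - a) * M) by ring.
rewrite -norm_CR.
apply (norm_RInt_le (V := C_R_NormedModule) f (fun _ => M) a b); trivial.
- intros x Hx; rewrite norm_CR; auto.
- apply (RInt_correct (V := CR)); assumption.
- apply: is_RInt_const.
Qed.

Lemma CInt_zero (g : R -> C) a b : (forall x, Rmin a b < x < Rmax a b -> g x = RtoC 0) ->
  is_CInt g a b (RtoC 0).
Proof.
intros H.
apply (is_RInt_ext (V := CR) (fun _ => RtoC 0)); [intros x Hx; symmetry; now apply H |].
pose proof (is_RInt_const (V := CR) a b (RtoC 0)) as I.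
assert (Z : scal (b - a) (RtoC 0 : CR) = RtoC 0) by apply (scal_zero_r (V := CR)).
rewrite Z in I; exact I.
Qed.

Lemma Cder_continuous (f : R -> C) (x : R) (l : C) :
  is_Cder f x l -> continuous (U := CR) f x.
Proof. intros H. apply (ex_derive_continuous (V := C_R_NormedModule)). now exists l. Qed.

Lemma Cmod_Cexp (z : C) : Cmod (Cexp z) = exp (Re z).
Proof.
unfold Cmod, Cexp; simpl.
replace (_ + _) with (exp (Re z) ^ 2 * (Rsqr (sin (Im z)) + Rsqr (cos (Im z)))) by (unfold Rsqr; ring).
rewrite sin2_cos2 Rmult_1_r sqrt_pow2; trivial. left; apply exp_pos.
Qed.

Lemma Cexp_plus (z w : C) : Cexp (z + w) = (Cexp z * Cexp w)%C.
Proof.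
unfold Cexp, Re, Im; apply injective_projections; simpl;
rewrite exp_plus ?cos_plus ?sin_plus; ring.
Qed.

Lemma Cexp_at_0 s : Cexp (- (s * RtoC 0)) = RtoC 1.
Proof.
replace (- (s * RtoC 0))%C with (RtoC 0) by ring.
unfold Cexp; apply injective_projections; simpl; rewrite exp_0 ?cos_0 ?sin_0; ring.
Qed.

Lemma Cexp_shift s x : (RtoC (exp x) * Cexp (- (s * RtoC x)) = Cexp (- ((s - 1) * RtoC x)))%C.
Proof.
replace (RtoC (exp x)) with (Cexp (RtoC x)).
- rewrite -Cexp_plus; f_equal; ring.
- unfold Cexp; apply injective_projections; simpl; rewrite ?cos_0 ?sin_0; ring.
Qed.

Lemma Cder_Cexp (s : C) (x : R) :
  is_Cder (fun t => Cexp (- (s * RtoC t))%C) x (- s * Cexp (- (s * RtoC x)))%C.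
Proof.
eapply Cder_eq.
- apply Cder_pair.
  + simpl; auto_derive; trivial.
  + simpl; auto_derive; trivial.
- apply injective_projections; simpl; unfold Rminus; ring.
Qed.

Lemma Cder_RtoC (f : R -> R) (x l : R) :
  is_derive f x l -> is_Cder (fun t => RtoC (f t)) x (RtoC l).
Proof. intros H. apply Cder_pair; trivial. apply: is_derive_const. Qed.

Lemma Cder_const (c : C) (x : R) : is_Cder (fun _ => c) x (RtoC 0).
Proof. apply: is_derive_const. Qed.
(** The derivative of f(x) e^(-zx) has integral zero because [f] vanishes at both ends. Keeping the
    factor z on the left avoids a division, so z = 0 is allowed. *)
Lemma CInt_parts (f f' : R -> C) (a b : R) (z : C) :
  (forall x, is_Cder f x (f' x)) -> (forall x, continuous (U := CR) f' x) ->
  f a = RtoC 0 -> f b = RtoC 0 ->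
  (z * CInt (fun x => f x * Cexp (- (z * RtoC x))) a b)%C =
  CInt (fun x => f' x * Cexp (- (z * RtoC x)))%C a b.
Proof.
intros Hf Hf' Ha Hb.
assert (HE : forall x, continuous (U := CR) (fun x => Cexp (- (z * RtoC x))%C) x).
{ intros x; eapply Cder_continuous, Cder_Cexp. }
assert (I1 : ex_CInt (fun x => f x * Cexp (- (z * RtoC x)))%C a b).
{ apply (ex_RInt_continuous (V := CR)); intros x _.
  eapply Cder_continuous, Cder_mult; [apply Hf | apply Cder_Cexp]. }
assert (I2 : ex_CInt (fun x => f' x * Cexp (- (z * RtoC x)))%C a b).
{ apply (ex_RInt_continuous (V := CR)); intros x _; now apply Ccont_mult. }
pose proof (RInt_correct (V := CR) _ _ _ I1) as J1.
pose proof (RInt_correct (V := CR) _ _ _ I2) as J2.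
pose proof (is_RInt_derive (V := CR) (fun x => f x * Cexp (- (z * RtoC x)))%C
  (fun x => f' x * Cexp (- (z * RtoC x)) + f x * (- z * Cexp (- (z * RtoC x))))%C a b) as D.
simpl in D.
assert (D' : is_CInt
  (fun x => f' x * Cexp (- (z * RtoC x)) + f x * (- z * Cexp (- (z * RtoC x))))%C a b (RtoC 0)).
{ replace (RtoC 0) with
   (minus ((f b * Cexp (- (z * RtoC b)))%C : CR) ((f a * Cexp (- (z * RtoC a)))%C : CR)).
  - apply D.
    + intros x _; apply Cder_mult; [apply Hf | apply Cder_Cexp].
    + intros x _. apply (continuous_plus (V := CR)); apply Ccont_mult; trivial.
      * eapply Cder_continuous, Hf.
      * apply Ccont_mult; trivial. apply: continuous_const.
  - rewrite Ha Hb; apply injective_projections; simpl;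
    unfold minus, plus, opp; simpl; unfold plus, opp; simpl; ring. }
pose proof (CInt_Cmult _ _ _ z _ J1) as J3.
pose proof (is_RInt_plus (V := CR) _ _ _ _ _ _ D' J3) as J4.
assert (J5 := is_RInt_unique (V := CR) _ _ _ _ J4).
change (plus (RtoC 0) ?u) with (RtoC 0 + u)%C in J5.
rewrite -[LHS]Cplus_0_l.
etransitivity; [symmetry; exact J5 |].
apply (RInt_ext (V := CR)); intros x _.
apply injective_projections; simpl; unfold plus; simpl; ring.
Qed.
(** * Oscillatory integrals *)

(** Differentiation preserves [p + q] and lowers [p] by at most one, so on an
    interval with sin = 0 at both ends [p] integrations by parts are free of
    boundary terms and cost a factor O(p + q) each. *)
Definition sincos (th a : R) (p q : nat) (x : R) : R :=
  sin (th * (x - a)) ^ p * cos (th * (x - a)) ^ q.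

Lemma is_derive_sincos (th a : R) (p q : nat) (x : R) :
  is_derive (sincos th a p q) x
    (th * (INR p * sincos th a (pred p) (S q) x - INR q * sincos th a (S p) (pred q) x)).
Proof. unfold sincos; auto_derive; trivial; unfold Rminus; simpl; ring. Qed.

Lemma pow_le_1_abs (x : R) (n : nat) : Rabs x <= 1 -> Rabs (x ^ n) <= 1.
Proof.
intros H; rewrite -RPow_abs -(pow1 n).
apply pow_incr; split; trivial; apply Rabs_pos.
Qed.

Lemma Rabs_sin_le (x : R) : Rabs (sin x) <= 1.
Proof. apply Rabs_le, SIN_bound. Qed.

Lemma Rabs_cos_le (x : R) : Rabs (cos x) <= 1.
Proof. apply Rabs_le, COS_bound. Qed.

Lemma Rabs_mult_le_1 (x y : R) : Rabs x <= 1 -> Rabs y <= 1 -> Rabs (x * y) <= 1.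
Proof.
intros Hx Hy; rewrite Rabs_mult -(Rmult_1_l 1).
apply Rmult_le_compat; trivial; apply Rabs_pos.
Qed.

Lemma sincos_le (th a : R) (p q : nat) (x : R) : Rabs (sincos th a p q x) <= 1.
Proof.
apply Rabs_mult_le_1; apply pow_le_1_abs; [apply Rabs_sin_le | apply Rabs_cos_le].
Qed.

Section Oscillation.
Variables (th a b M : R) (z : C) (w : nat -> R -> C).
Hypothesis Hw : forall i x, is_Cder (w i) x (w (S i) x).
Hypothesis th_ge0 : 0 <= th.
Hypothesis Hab : a <= b.
Hypothesis Hb : sin (th * (b - a)) = 0.
Hypothesis Hz : z <> RtoC 0.
Hypothesis HM : forall i x, a <= x <= b -> Cmod (w i x * Cexp (- (z * RtoC x)))%C <= M.

Let F (i p q : nat) (x : R) : C := (w i x * RtoC (sincos th a p q x))%C.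

Let J (i p q : nat) : C := CInt (fun x => F i p q x * Cexp (- (z * RtoC x)))%C a b.

Lemma Cder_F i p q x : is_Cder (F i p q) x
  (F (S i) p q x + (RtoC (th * INR p) * F i (pred p) (S q) x
     + RtoC (- (th * INR q)) * F i (S p) (pred q) x))%C.
Proof.
eapply Cder_eq.
- apply Cder_mult; [apply Hw | apply Cder_RtoC, is_derive_sincos].
- apply injective_projections; simpl; ring.
Qed.

Lemma cont_F i p q x : continuous (U := CR) (F i p q) x.
Proof. eapply Cder_continuous, Cder_F. Qed.

Lemma ex_J i p q : ex_CInt (fun x => F i p q x * Cexp (- (z * RtoC x)))%C a b.
Proof.
apply (ex_RInt_continuous (V := CR)); intros x _; apply Ccont_mult.
- apply cont_F.
- eapply Cder_continuous, Cder_Cexp.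
Qed.

(** Since p >= 1 there is a sine factor, which kills the boundary term at [a] trivially and at [b]
    by [Hb]. The three terms come from differentiating the weight, the sine power and the cosine
    power. *)
Lemma J_parts i p q : (1 <= p)%nat ->
  (z * J i p q = J (S i) p q + (RtoC (th * INR p) * J i (pred p) (S q)
     + RtoC (- (th * INR q)) * J i (S p) (pred q)))%C.
Proof.
intros Hp.
assert (F0 : forall x, sin (th * (x - a)) = 0 -> F i p q x = RtoC 0).
{ intros x Hx; unfold F, sincos; rewrite Hx pow_i; [| lia].
  rewrite Rmult_0_l; apply Cmult_0_r. }
unfold J at 1.
rewrite (CInt_parts (F i p q) _ a b z (Cder_F i p q)); cycle 1.
- intros x; apply (continuous_plus (V := CR)); [apply cont_F |].
  apply (continuous_plus (V := CR)); apply Ccont_mult;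
  [apply: continuous_const | apply cont_F | apply: continuous_const | apply cont_F].
- apply F0; rewrite Rminus_diag Rmult_0_r; apply sin_0.
- apply F0; trivial.
- apply (is_RInt_unique (V := CR)).
  assert (H : is_CInt (fun x => plus (F (S i) p q x * Cexp (- (z * RtoC x)))%C
     (plus (RtoC (th * INR p) * (F i (pred p) (S q) x * Cexp (- (z * RtoC x))))
        (RtoC (- (th * INR q)) * (F i (S p) (pred q) x * Cexp (- (z * RtoC x)))))%C) a b
     (plus (J (S i) p q : CR) (plus (RtoC (th * INR p) * J i (pred p) (S q))%C
     (RtoC (- (th * INR q)) * J i (S p) (pred q))%C))).
  { apply (is_RInt_plus (V := CR)); [| apply (is_RInt_plus (V := CR))];
    [| apply CInt_Cmult | apply CInt_Cmult]; apply (RInt_correct (V := CR)), ex_J. }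
  revert H; apply (is_RInt_ext (V := CR)); intros x _.
  apply injective_projections; simpl; unfold plus; simpl; ring.
Qed.

(** Induction on the number N of integrations by parts. One step replaces the integral by three
    whose coefficients add up to at most 1 + p th + q th = 1 + K th, divided by |z|. The induction
    needs every [i] at once, because the weight gets differentiated along the way; hence the bound
    [M] uniform in [i]. *)
Lemma oscillation_bound (K N i p q : nat) : (p + q = K)%nat -> (N <= p)%nat ->
  Cmod (J i p q) <= M * (b - a) * ((1 + INR K * th) / Cmod z) ^ N.
Proof.
revert i p q; induction N as [|N IH]; intros i p q Hpq HN.
- rewrite pow_O Rmult_1_r.
  apply CInt_norm_le; trivial; [apply ex_J |].
  intros x Hx; unfold F.
  replace (_ * _)%C with (RtoC (sincos th a p q x) * (w i x * Cexp (- (z * RtoC x))))%C by ring.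
  rewrite Cmod_mult Cmod_R -(Rmult_1_l M).
  apply Rmult_le_compat; auto using Rabs_pos, Cmod_ge_0, sincos_le.
- assert (Hz' : 0 < Cmod z) by now apply Cmod_gt_0.
  set (B := M * (b - a) * ((1 + INR K * th) / Cmod z) ^ N) in *.
  assert (Hq : 0 <= th * INR q) by (apply Rmult_le_pos; auto using pos_INR).
  assert (Hp' : 0 <= th * INR p) by (apply Rmult_le_pos; auto using pos_INR).
  assert (H1 : Cmod (J (S i) p q) <= B) by (apply IH; lia).
  assert (H2 : Cmod (RtoC (th * INR p) * J i (pred p) (S q)) <= th * INR p * B).
  { rewrite Cmod_mult Cmod_R Rabs_pos_eq; trivial.
    apply Rmult_le_compat_l; trivial; apply IH; lia. }
  assert (H3 : Cmod (RtoC (- (th * INR q)) * J i (S p) (pred q)) <= th * INR q * B).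
  { rewrite Cmod_mult Cmod_R Rabs_Ropp Rabs_pos_eq; trivial.
    (* For q = 0 the pair (p + 1, [pred 0]) would break p + q = K, but its coefficient is zero. *)
    destruct q as [|q]; [simpl; lra |].
    apply Rmult_le_compat_l; trivial; apply IH; simpl; lia. }
  assert (H : Cmod z * Cmod (J i p q) <= (1 + INR K * th) * B).
  { rewrite -Cmod_mult J_parts; [| lia].
    eapply Rle_trans; [apply Cmod_triangle |].
    assert (T := Cmod_triangle (RtoC (th * INR p) * J i (pred p) (S q))
      (RtoC (- (th * INR q)) * J i (S p) (pred q))).
    rewrite -Hpq plus_INR. nra. }
  apply (Rmult_le_reg_l (Cmod z)); trivial.
  eapply Rle_trans; [exact H |].
  right; unfold B; simpl; field; lra.
Qed.
End Oscillation.
(** * Series of entire functions *)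

Notation is_Cseries := (is_series (K := C_AbsRing) (V := C_NormedModule)).

Lemma Cmod_series_le (a : nat -> C) (b : nat -> R) (l : C) (m : R) :
  (forall n, Cmod (a n) <= b n) -> is_Cseries a l -> is_series b m -> Cmod l <= m.
Proof.
intros Hab Ha Hb.
assert (Hs : forall n, Cmod (sum_n (G := C_NormedModule) a n) <= sum_n b n).
{ induction n as [|n IH].
  - rewrite !sum_O; apply Hab.
  - rewrite !sum_Sn; eapply Rle_trans; [apply Cmod_triangle |].
    apply Rplus_le_compat; trivial; apply Hab. }
apply (filterlim_le (F := eventually)
  (fun n => Cmod (sum_n (G := C_NormedModule) a n)) (sum_n b) (Finite (Cmod l)) (Finite m)).
- now exists 0%nat.
- assert (HN : filterlim Cmod (locally (T := C_NormedModule) l) (locally (Cmod l)))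
    by exact (filterlim_norm (V := C_NormedModule) l).
  exact (filterlim_comp _ _ _ _ _ _ _ _ Ha HN).
- exact Hb.
Qed.

(** Unlike differentiability, a bound on the second-order remainder can be summed
    over a series of functions. *)
Definition quadratically_approx (G : C -> C) (z : C) : Prop :=
  exists (D : C) (M : R),
    forall h, Cmod h <= 1 -> Cmod (G (z + h) - G z - h * D)%C <= M * Cmod h ^ 2.

Lemma quadratically_approx_ex_derive (G : C -> C) (z : C) : quadratically_approx G z ->
  ex_derive (K := C_AbsRing) (V := C_NormedModule) G z.
Proof.
intros (D & M & HM); exists D; split; [apply is_linear_scal_l |].
intros x Hx eps.
rewrite -(is_filter_lim_locally_unique _ _ Hx); clear x Hx.
assert (HM0 : 0 <= M).
{ assert (H1 : Cmod (RtoC 1) <= 1) by (rewrite Cmod_1; lra).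
  specialize (HM _ H1). rewrite Cmod_1 in HM.
  assert (H0 := Cmod_ge_0 (G (z + 1) - G z - 1 * D)%C); lra. }
(* The bound M |h|^2 is at most eps |h| once |h| <= eps / (M + 1); adding 1 to M covers M = 0. *)
assert (Hd : 0 < Rmin 1 (eps / (M + 1))).
{ apply Rmin_pos; [lra |]; apply Rdiv_lt_0_compat; [apply cond_pos | lra]. }
exists (mkposreal _ Hd); intros y' Hy; pose (y := y' : C); fold y.
change (Cmod (y - z)%C < Rmin 1 (eps / (M + 1))) in Hy.
clearbody y; clear y'.
change (Cmod ((G y - G z) - (y - z) * D)%C <= eps * Cmod (y - z)%C).
set (h := (y - z)%C) in *.
assert (Hyz : y = (z + h)%C) by (unfold h; ring).
rewrite Hyz.
assert (h1 : Cmod h <= 1) by (apply Rlt_le, Rlt_le_trans with (1 := Hy), Rmin_l).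
assert (h2 : Cmod h <= eps / (M + 1)) by (apply Rlt_le, Rlt_le_trans with (1 := Hy), Rmin_r).
eapply Rle_trans; [now apply HM |].
rewrite /= Rmult_1_r -Rmult_assoc.
apply Rmult_le_compat_r; [apply Cmod_ge_0 |].
apply Rle_trans with (M * (eps / (M + 1))).
- now apply Rmult_le_compat_l.
- assert (E : eps = eps / (M + 1) * (M + 1) :> R) by (field; lra).
  assert (0 < eps / (M + 1)) by (apply Rdiv_lt_0_compat; [apply cond_pos | lra]).
  rewrite {2}E; nra.
Qed.

(** The remainder estimates are summed term by term. No bound on H' is assumed: at h = 1 the
    remainder expresses H'(z) by H(z + 1), H(z) and a term of size B n, so |H'(z)| <= 3 B n and the
    series of derivatives converges. *)
Lemma entire_series (H H' : nat -> C -> C) :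
  (forall R0 : R, exists B : nat -> R, ex_series B /\
     forall n s h, Cmod s <= R0 -> Cmod h <= 1 ->
       Cmod (H n s) <= B n /\
       Cmod (H n (s + h) - H n s - h * H' n s)%C <= B n * Cmod h ^ 2) ->
  exists G : C -> C, (forall z, quadratically_approx G z) /\ forall s, is_Cseries (fun n => H n s) (G s).
Proof.
intros HB.
assert (EH : forall s, exists l, is_Cseries (fun n => H n s) l).
{ intros s; destruct (HB (Cmod s)) as (B & eB & hB).
  apply (ex_series_le (V := C_CompleteNormedModule) _ B); trivial.
  intros n; apply (hB n s (RtoC 0)); [lra | rewrite Cmod_0; lra]. }
destruct (functional_choice _ EH) as [G HG].
exists G; split; trivial.
intros z.
(* The radius is enlarged by 1 so that the disc also contains z + 1. *)
destruct (HB (Cmod z + 1)) as (B & eB & hB).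
assert (h1 : Cmod (RtoC 1) <= 1) by (rewrite Cmod_1; lra).
assert (EH' : exists l, is_Cseries (fun n => H' n z) l).
{ apply (ex_series_le (V := C_CompleteNormedModule) _ (fun n => scal 3 (B n))).
  - intros n.
    destruct (hB n z (RtoC 1)) as [b1 b2]; [lra | trivial |].
    destruct (hB n (z + 1)%C (RtoC 1)) as [b3 _]; [| trivial |].
    { eapply Rle_trans; [apply Cmod_triangle | lra]. }
    rewrite Cmod_1 in b2.
    change (Cmod (H' n z) <= 3 * B n).
    replace (H' n z) with (H n (z + 1) + (- H n z + - (H n (z + 1) - H n z - 1 * H' n z)))%C by ring.
    eapply Rle_trans; [apply Cmod_triangle |].
    assert (T := Cmod_triangle (- H n z)%C (- (H n (z + 1) - H n z - 1 * H' n z))%C).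
    rewrite !Cmod_opp in T. lra.
  - now apply: ex_series_scal. }
destruct EH' as [D HD].
exists D, (Series B).
intros h Hh.
apply (Cmod_series_le (fun n => H n (z + h) - H n z - h * H' n z)%C (fun n => B n * Cmod h ^ 2)).
- intros n; apply hB; trivial; lra.
- apply (is_series_minus (V := C_NormedModule) (fun n => (H n (z + h) - H n z)%C)).
  + apply (is_series_minus (V := C_NormedModule) (fun n => (H n (z + h))%C)); apply HG.
  + apply (is_series_scal (V := C_NormedModule) h); trivial.
- apply (is_series_ext (fun n => scal (Cmod h ^ 2) (B n))).
  + intros n; apply Rmult_comm.
  + rewrite Rmult_comm; apply: is_series_scal; now apply Series_correct.
Qed.
(** * Smooth cutoff *)

(** The powers [y ^ m] make the family closed under differentiation. *)
Definition flat (d : R) (m : nat) (y : R) : R :=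
  match Rlt_dec 0 y with left _ => exp (- (d / y)) / y ^ m | right _ => 0 end.

Lemma flat_pos (d : R) (m : nat) (y : R) : 0 < y -> flat d m y = exp (- (d / y)) / y ^ m.
Proof. intros Hy; unfold flat; destruct (Rlt_dec 0 y); tauto. Qed.

Lemma flat_neg (d : R) (m : nat) (y : R) : y <= 0 -> flat d m y = 0.
Proof. intros Hy; unfold flat; destruct (Rlt_dec 0 y); trivial; lra. Qed.

(** For n > 0, raise u <= e^u at u = t / n to the n-th power, which gives M = n^n. *)
Lemma pow_le_exp (n : nat) : exists M, 0 <= M /\ forall t, 0 <= t -> t ^ n <= M * exp t.
Proof.
assert (E : forall j t, exp (INR j * t) = exp t ^ j).
{ induction j as [|j IH]; intros t.
  - rewrite Rmult_0_l; apply exp_0.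
  - rewrite S_INR /= -IH -exp_plus; f_equal; ring. }
destruct n as [|n].
- exists 1; split; [lra |]; intros t Ht. assert (H := exp_ineq1_le t); simpl; lra.
- assert (Hn : 0 < INR (S n)) by (apply lt_0_INR; lia).
  exists (INR (S n) ^ S n); split; [apply pow_le; lra |].
  intros t Ht.
  replace t with (INR (S n) * (t / INR (S n))) by (field; lra).
  rewrite E Rpow_mult_distr.
  apply Rmult_le_compat_l; [apply pow_le; lra |].
  assert (0 <= t / INR (S n)) by (apply Rdiv_le_0_compat; lra).
  apply pow_incr; split; trivial.
  assert (H' := exp_ineq1_le (t / INR (S n))); lra.
Qed.

(** Apply [pow_le_exp] with exponent m + 2 at t = d / y: m powers cancel the denominator and two
    remain. Quadratic decay is what makes the difference quotient at 0 tend to 0. *)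
Lemma flat_quadratic (d : R) (m : nat) : 0 < d ->
  exists M, 0 <= M /\ forall y, Rabs (flat d m y) <= M * y ^ 2.
Proof.
intros Hd; destruct (pow_le_exp (m + 2)) as (M & HM0 & HM).
assert (Hdm : 0 < d ^ (m + 2)) by now apply pow_lt.
exists (M / d ^ (m + 2)); split; [now apply Rdiv_le_0_compat |].
intros y; destruct (Rlt_dec 0 y) as [Hy | Hy].
- rewrite flat_pos; trivial.
  assert (Hym : 0 < y ^ m) by now apply pow_lt.
  rewrite Rabs_pos_eq; [| apply Rdiv_le_0_compat; trivial; left; apply exp_pos].
  specialize (HM (d / y)); rewrite exp_Ropp.
  assert (He := exp_pos (d / y)).
  assert (H1 : (d / y) ^ (m + 2) <= M * exp (d / y)) by (apply HM, Rdiv_le_0_compat; lra).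
  unfold Rdiv in H1 at 1; rewrite Rpow_mult_distr pow_inv in H1.
  assert (Hy2 : y ^ (m + 2) = y ^ m * y ^ 2) by apply pow_add.
  apply (Rmult_le_reg_r (exp (d / y))); trivial.
  apply (Rmult_le_reg_r (d ^ (m + 2) / y ^ 2)).
  { apply Rdiv_lt_0_compat; trivial; nra. }
  rewrite Hy2 in H1.
  replace (_ * _ * _) with (d ^ (m + 2) * / (y ^ m * y ^ 2)).
  + replace (M / _ * _ * _ * _) with (M * exp (d / y)); trivial.
    field; split; lra.
  + field; repeat split; lra.
- rewrite flat_neg; [| lra]. rewrite Rabs_R0.
  apply Rmult_le_pos; [now apply Rdiv_le_0_compat | apply pow2_ge_0].
Qed.

(** Away from 0 the function agrees locally with a constant or with the explicit formula. At 0 the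
    difference quotient is O(h) by [flat_quadratic]. *)
Lemma is_derive_flat (d : R) (m : nat) (y : R) : 0 < d ->
  is_derive (flat d m) y (d * flat d (S (S m)) y - INR m * flat d (S m) y).
Proof.
intros Hd; destruct (Rtotal_order y 0) as [Hy | [Hy | Hy]].
- apply (is_derive_ext_loc (fun _ => 0)).
  + apply (filter_imp (fun t => t < 0)); [| now apply (open_lt 0)].
    intros t Ht; rewrite flat_neg; lra.
  + rewrite !flat_neg; try lra.
    replace (_ - _) with 0 by ring. apply: is_derive_const.
- subst y; rewrite !flat_neg; try lra; replace (_ - _) with 0 by ring.
  destruct (flat_quadratic d m Hd) as (M & HM0 & HM).
  apply is_derive_Reals; intros eps Heps.
  assert (He : 0 < eps / (M + 1)) by (apply Rdiv_lt_0_compat; lra).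
  exists (mkposreal _ He); intros h Hh Hlt; simpl in Hlt.
  rewrite Rplus_0_l (flat_neg d m 0); [| lra].
  rewrite !Rminus_0_r /Rdiv Rabs_mult Rabs_inv.
  assert (Hh' := Rabs_pos_lt _ Hh).
  apply Rle_lt_trans with (M * Rabs h).
  + apply (Rmult_le_reg_r (Rabs h)); trivial.
    rewrite Rmult_assoc Rinv_l; [| lra].
    eapply Rle_trans; [rewrite Rmult_1_r; apply HM |].
    rewrite -(pow2_abs h); right; ring.
  + apply Rle_lt_trans with (M * (eps / (M + 1))); [apply Rmult_le_compat_l; lra |].
    apply (Rmult_lt_reg_r (M + 1)); [lra |].
    replace (_ * _ * _) with (M * eps) by (field; lra). nra.
- apply (is_derive_ext_loc (fun t => exp (- (d / t)) / t ^ m)).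
  + apply (filter_imp (fun t => 0 < t)); [| now apply (open_gt 0)].
    intros t Ht; rewrite flat_pos; trivial.
  + rewrite !flat_pos; trivial.
    assert (Hym : 0 < y ^ m) by now apply pow_lt.
    auto_derive; [repeat split; lra |]; change (d * / y) with (d / y).
    destruct m as [|m]; simpl pred; [simpl; field; lra |].
    assert (Hym' : 0 < y ^ m) by now apply pow_lt.
    simpl pow; field; split; lra.
Qed.

(** A syntactic class containing the bumps and closed under differentiation. Smoothness of all
    orders follows by induction on the order, without any formula for iterated derivatives. *)
Inductive elementary : (R -> R) -> Prop :=
| elementary_const c : elementary (fun _ => c)
| elementary_id : elementary (fun x => x)
| elementary_plus f g : elementary f -> elementary g -> elementary (fun x => f x + g x)
| elementary_opp f : elementary f -> elementary (fun x => - f x)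
| elementary_mult f g : elementary f -> elementary g -> elementary (fun x => f x * g x)
| elementary_sin f : elementary f -> elementary (fun x => sin (f x))
| elementary_cos f : elementary f -> elementary (fun x => cos (f x))
| elementary_flat d m f : 0 < d -> elementary f -> elementary (fun x => flat d m (f x)).

Lemma elementary_derive f : elementary f ->
  exists f', elementary f' /\ forall x, is_derive f x (f' x).
Proof.
induction 1 as [c | | f g Hf (f' & Ef & Df) Hg (g' & Eg & Dg)
  | f Hf (f' & Ef & Df) | f g Hf (f' & Ef & Df) Hg (g' & Eg & Dg) | f Hf (f' & Ef & Df)
  | f Hf (f' & Ef & Df) | d m f Hd Hf (f' & Ef & Df)].
- exists (fun _ => 0); split; [constructor |]; intros x; apply: is_derive_const.
- exists (fun _ => 1); split; [constructor |]; intros x; apply: is_derive_id.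
- exists (fun x => f' x + g' x); split; [now constructor |].
  intros x; now apply: is_derive_plus.
- exists (fun x => - f' x); split; [now constructor |].
  intros x; now apply: is_derive_opp.
- exists (fun x => f' x * g x + f x * g' x); split; [now repeat constructor |].
  intros x; apply: is_derive_mult; trivial; intros; apply Rmult_comm.
- exists (fun x => f' x * cos (f x)); split; [now repeat constructor |].
  intros x; apply: (is_derive_comp sin f); trivial; apply is_derive_sin.
- exists (fun x => f' x * ((-1) * sin (f x))); split; [now repeat constructor |].
  intros x; apply: (is_derive_comp cos f); trivial.
  replace (-1 * sin (f x)) with (- sin (f x)) by ring; apply is_derive_cos.
- exists (fun x => f' x * (d * flat d (S (S m)) (f x) + (- INR m) * flat d (S m) (f x))).
  split; [now repeat constructor |].
  intros x; apply: (is_derive_comp (flat d m) f); trivial.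
  replace (_ + _) with (d * flat d (S (S m)) (f x) - INR m * flat d (S m) (f x)) by ring.
  now apply is_derive_flat.
Qed.

Lemma elementary_continuous f x : elementary f -> continuous f x.
Proof.
intros Hf; destruct (elementary_derive f Hf) as (f' & _ & D).
apply: ex_derive_continuous; now exists (f' x).
Qed.

Lemma elementary_ext_derive_n f n : elementary f ->
  exists g, elementary g /\ forall x, Derive_n f n x = g x.
Proof.
intros Hf; induction n as [|n (g & Hg & E)]; [now exists f |].
destruct (elementary_derive g Hg) as (g' & Hg' & D).
exists g'; split; trivial; intros x; simpl.
rewrite (Derive_ext _ _ _ E); now apply is_derive_unique.
Qed.

Lemma elementary_smooth f n x : elementary f -> ex_derive_n f n x.
Proof.
intros Hf; destruct n as [|n]; [exact I |]; simpl.
destruct (elementary_ext_derive_n f n Hf) as (g & Hg & E).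
destruct (elementary_derive g Hg) as (g' & _ & D).
exists (g' x); now apply (is_derive_ext g).
Qed.

Lemma elementary_pow f n : elementary f -> elementary (fun x => f x ^ n).
Proof. intros Hf; induction n; simpl; now constructor. Qed.
Lemma exp_le (x y : R) : x <= y -> exp x <= exp y.
Proof. intros [H | <-]; [left; now apply exp_increasing | right; trivial]. Qed.

(** * The bumps and their transforms *)

Definition window (k : nat) (x : R) : R := (x - INR k) * (2 * INR k - x).

Definition carrier (k : nat) (lam x : R) : R :=
  sincos (PI / INR k) (INR k) k 0 x * cos (lam * (x - 3 / 2 * INR k)).

Definition bump (k : nat) (lam d x : R) : R :=
  flat d 0 (window k x) * carrier k lam x.

Lemma flat_0_bound (d y : R) : 0 < d -> 0 <= flat d 0 y <= 1.
Proof.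
intros Hd; destruct (Rlt_dec 0 y) as [Hy | Hy].
- rewrite flat_pos // /= Rdiv_1_r; split; [left; apply exp_pos |].
  rewrite -exp_0; apply exp_le.
  assert (0 < d / y) by now apply Rdiv_lt_0_compat. lra.
- rewrite flat_neg; lra.
Qed.

Lemma carrier_le (k : nat) (lam x : R) : Rabs (carrier k lam x) <= 1.
Proof. apply Rabs_mult_le_1; [apply sincos_le | apply Rabs_cos_le]. Qed.

Lemma bump_out (k : nat) (lam d x : R) : x <= INR k \/ 2 * INR k <= x -> bump k lam d x = 0.
Proof.
intros Hx; unfold bump; rewrite flat_neg; [ring |].
assert (H := pos_INR k); unfold window; nra.
Qed.

Lemma bump_le (k : nat) (lam d x : R) : 0 < d -> Rabs (bump k lam d x) <= 1.
Proof.
intros Hd; apply Rabs_mult_le_1; [| apply carrier_le].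
assert (H := flat_0_bound d (window k x) Hd); rewrite Rabs_pos_eq; tauto.
Qed.

Lemma elementary_affine (u v : R) : elementary (fun x => u * (x + v)).
Proof. repeat constructor. Qed.

Lemma elementary_carrier (k : nat) (lam : R) : elementary (carrier k lam).
Proof.
apply (elementary_mult (sincos (PI / INR k) (INR k) k 0)
  (fun x => cos (lam * (x - 3 / 2 * INR k)))).
- apply (elementary_mult (fun x => sin (PI / INR k * (x - INR k)) ^ k)
    (fun x => cos (PI / INR k * (x - INR k)) ^ 0)); apply elementary_pow;
  [apply elementary_sin | apply elementary_cos]; apply elementary_affine.
- apply elementary_cos, elementary_affine.
Qed.

Lemma elementary_bump (k : nat) (lam d : R) : 0 < d -> elementary (bump k lam d).
Proof.
intros Hd.
apply (elementary_mult (fun x => flat d 0 (window k x)) (carrier k lam));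
  [| apply elementary_carrier].
apply elementary_flat; trivial.
apply (elementary_mult (fun x => x - INR k) (fun x => 2 * INR k - x)).
- apply (elementary_plus (fun x => x) (fun _ => - INR k)); constructor.
- apply (elementary_plus (fun _ => 2 * INR k) (fun x => - x)); repeat constructor.
Qed.

Lemma INR_ge_2 (k : nat) : (2 <= k)%nat -> 2 <= INR k.
Proof. intros H; now apply (le_INR 2). Qed.

Section Bump.
Variables (k : nat) (lam d : R).
Hypothesis Hk : (2 <= k)%nat.
Hypothesis Hd : 0 < d.

(** By symmetry the sine is at most pi / k times the distance to either end. Weighting each
    inequality by the distance to the other end and adding gives the claim, since the two distances
    sum to k. A sine factor can thus cancel a power of [window] in a denominator. *)
Lemma sin_le_window x : INR k <= x <= 2 * INR k ->
  0 <= sin (PI / INR k * (x - INR k)) <= 2 * PI / INR k ^ 2 * window k x.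
Proof.
intros Hx; assert (K := INR_ge_2 k Hk); assert (P := PI_RGT_0).
assert (Hth : 0 < PI / INR k) by (apply Rdiv_lt_0_compat; lra).
assert (S : forall u, 0 <= u -> sin u <= u).
{ intros u [Hu | <-]; [left; now apply sin_lt_x | rewrite sin_0; lra]. }
assert (E : sin (PI / INR k * (x - INR k)) = sin (PI / INR k * (2 * INR k - x))).
{ rewrite -sin_PI_x; f_equal; field; lra. }
split.
- apply sin_ge_0; [apply Rmult_le_pos; lra |].
  replace PI with (PI / INR k * INR k) at 2 by (field; lra).
  apply Rmult_le_compat_l; lra.
- assert (S1 := S (PI / INR k * (x - INR k)) ltac:(apply Rmult_le_pos; lra)).
  assert (S2 := S (PI / INR k * (2 * INR k - x)) ltac:(apply Rmult_le_pos; lra)).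
  rewrite -E in S2; set (s := sin _) in *; unfold window.
  apply (Rmult_le_reg_r (INR k)); [lra |].
  replace (2 * PI / INR k ^ 2 * ((x - INR k) * (2 * INR k - x)) * INR k) with
    (PI / INR k * (x - INR k) * (2 * INR k - x) + PI / INR k * (2 * INR k - x) * (x - INR k))
    by (field; lra).
  nra.
Qed.

(** The defect 1 - e^(-d/W) <= d / W blows up at the ends of the support, but one sine factor is at
    most 8 W there, using 2 pi <= 8. *)
Lemma bump_approx x : INR k <= x <= 2 * INR k ->
  Rabs (bump k lam d x - carrier k lam x) <= 8 * d.
Proof.
intros Hx; assert (K := INR_ge_2 k Hk); assert (P := PI_RGT_0); assert (P4 := PI_4).
assert (Hs := sin_le_window x Hx).
assert (Hs1 := SIN_bound (PI / INR k * (x - INR k))).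
unfold bump, carrier, sincos.
rewrite pow_O Rmult_1_r.
set (s := sin _) in *; set (c := cos _).
replace (_ - _) with ((flat d 0 (window k x) - 1) * s * (s ^ pred k * c)).
2: { replace (s ^ k) with (s * s ^ pred k) by (rewrite tech_pow_Rmult; f_equal; lia). ring. }
rewrite Rabs_mult.
assert (B : Rabs (s ^ pred k * c) <= 1).
{ apply Rabs_mult_le_1; [apply pow_le_1_abs, Rabs_le; lra | apply Rabs_cos_le]. }
assert (A : Rabs ((flat d 0 (window k x) - 1) * s) <= 8 * d); cycle 1.
{ assert (0 <= Rabs ((flat d 0 (window k x) - 1) * s)) by apply Rabs_pos.
  assert (0 <= Rabs (s ^ pred k * c)) by apply Rabs_pos. nra. }
assert (K2 : 1 <= INR k ^ 2) by nra.
assert (C8 : 2 * PI / INR k ^ 2 <= 8).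
{ apply (Rmult_le_reg_r (INR k ^ 2)); [lra |].
  replace (2 * PI / INR k ^ 2 * INR k ^ 2) with (2 * PI) by (field; lra). nra. }
rewrite Rabs_mult (Rabs_pos_eq s); [| tauto].
destruct (Rlt_dec 0 (window k x)) as [W | W].
- rewrite flat_pos // pow_O Rdiv_1_r.
  assert (D : 0 < d / window k x) by now apply Rdiv_lt_0_compat.
  assert (E1 := exp_ineq1_le (- (d / window k x))).
  assert (E2 : exp (- (d / window k x)) <= 1) by (rewrite -exp_0; apply exp_le; lra).
  rewrite Rabs_left1; [| lra].
  apply Rle_trans with (d / window k x * (8 * window k x)).
  + apply Rmult_le_compat; try lra. nra.
  + right; field; lra.
- assert (0 <= 2 * PI / INR k ^ 2) by (apply Rdiv_le_0_compat; lra).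
  assert (s = 0) as -> by nra. lra.
Qed.

(** At the centre sine and cosine equal 1 and the window is k^2 / 4 >= 1, so the value is at least
    e^(-d) >= 1 - d. *)
Lemma bump_mid : d <= 1 / 2 -> 1 / 2 <= bump k lam d (3 / 2 * INR k).
Proof.
intros Hd2; assert (K := INR_ge_2 k Hk).
unfold bump, carrier, sincos.
replace (PI / INR k * (3 / 2 * INR k - INR k)) with (PI / 2) by (field; lra).
rewrite sin_PI2 Rminus_diag Rmult_0_r cos_0 pow1 pow_O.
unfold window.
replace ((3 / 2 * INR k - INR k) * (2 * INR k - 3 / 2 * INR k)) with (INR k ^ 2 / 4) by field.
rewrite flat_pos; [| nra]. rewrite pow_O Rdiv_1_r.
assert (d / (INR k ^ 2 / 4) <= d).
{ apply (Rmult_le_reg_r (INR k ^ 2 / 4)); [nra |].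
  replace (d / (INR k ^ 2 / 4) * (INR k ^ 2 / 4)) with d by (field; lra).
  assert (4 <= INR k ^ 2) by nra. nra. }
assert (E1 := exp_ineq1_le (- (d / (INR k ^ 2 / 4)))). lra.
Qed.

(** The derivative of the cutoff contributes 8. The sine power contributes k (pi / k) = pi <= 4, and
    the cosine contributes [lam]. For the cutoff, W^2 in the denominator is absorbed by two sine
    factors, leaving at most (64 / k^4) k <= 64 / 2^3. *)
Lemma bump_derive_le x : 0 <= lam -> d <= 1 -> Rabs (Derive (bump k lam d) x) <= 12 + lam.
Proof.
intros Hlam Hd1; assert (K := INR_ge_2 k Hk); assert (P := PI_RGT_0); assert (P4 := PI_4).
set (s := sin (PI / INR k * (x - INR k))).
set (c := cos (lam * (x - 3 / 2 * INR k))).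
rewrite (is_derive_unique _ _
  (d * flat d 2 (window k x) * (3 * INR k - 2 * x) * (s ^ k * c) +
   flat d 0 (window k x) *
   ((PI / INR k) * (INR k * sincos (PI / INR k) (INR k) (pred k) 1 x) * c
    + s ^ k * (- lam * sin (lam * (x - 3 / 2 * INR k)))))).
- assert (T1 : Rabs (d * flat d 2 (window k x) * (3 * INR k - 2 * x) * (s ^ k * c)) <= 8).
  { destruct (Rlt_dec 0 (window k x)) as [W | W]; cycle 1.
    { rewrite flat_neg; [| lra]. rewrite Rmult_0_r !Rmult_0_l Rabs_R0; lra. }
    assert (Hx : INR k <= x <= 2 * INR k).
    { unfold window in W. split; apply Rnot_lt_le; intros H; nra. }
    assert (Hs := sin_le_window x Hx); fold s in Hs.
    assert (Hs1 := SIN_bound (PI / INR k * (x - INR k))); fold s in Hs1.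
    assert (B : Rabs (s ^ (k - 2) * c) <= 1).
    { apply Rabs_mult_le_1; [apply pow_le_1_abs, Rabs_le; lra | apply Rabs_cos_le]. }
    (* Splitting off the two sine factors that compensate W^2 requires k >= 2. *)
    replace (s ^ k) with (s ^ 2 * s ^ (k - 2)) by (rewrite -pow_add; f_equal; lia).
    replace (d * flat d 2 (window k x) * (3 * INR k - 2 * x) * (s ^ 2 * s ^ (k - 2) * c)) with
      ((d * flat d 2 (window k x) * s ^ 2 * (3 * INR k - 2 * x)) * (s ^ (k - 2) * c)) by ring.
    rewrite Rabs_mult.
    assert (A : Rabs (d * flat d 2 (window k x) * s ^ 2 * (3 * INR k - 2 * x)) <= 8); cycle 1.
    { assert (0 <= Rabs (d * flat d 2 (window k x) * s ^ 2 * (3 * INR k - 2 * x))) by apply Rabs_pos.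
      assert (0 <= Rabs (s ^ (k - 2) * c)) by apply Rabs_pos. nra. }
    rewrite flat_pos //.
    assert (D : 0 < d / window k x) by now apply Rdiv_lt_0_compat.
    assert (E2 : exp (- (d / window k x)) <= 1) by (rewrite -exp_0; apply exp_le; lra).
    assert (E0 := exp_pos (- (d / window k x))).
    set (e := exp _) in *.
    assert (W2 : 0 < window k x ^ 2) by now apply pow_lt.
    assert (Hk3 : 0 <= 64 / INR k ^ 4).
    { apply Rdiv_le_0_compat; [lra | apply pow_lt; lra]. }
    assert (Hs2 : s ^ 2 / window k x ^ 2 <= 64 / INR k ^ 4).
    { apply (Rmult_le_reg_r (window k x ^ 2)); trivial.
      replace (s ^ 2 / window k x ^ 2 * window k x ^ 2) with (s ^ 2) by (field; lra).
      apply Rle_trans with ((8 / INR k ^ 2 * window k x) ^ 2).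
      - apply pow_incr; split; [tauto |].
        apply Rle_trans with (1 := proj2 Hs), Rmult_le_compat_r; [lra |].
        apply Rmult_le_compat_r; [left; apply Rinv_0_lt_compat; nra | lra].
      - right; field; lra. }
    assert (0 <= s ^ 2 / window k x ^ 2) by (apply Rdiv_le_0_compat; [apply pow2_ge_0 | lra]).
    rewrite Rabs_mult.
    apply Rle_trans with (64 / INR k ^ 4 * INR k).
    - apply Rmult_le_compat; try apply Rabs_pos.
      + replace (d * (e / window k x ^ 2) * s ^ 2) with (d * e * (s ^ 2 / window k x ^ 2)) by (field; lra).
        rewrite Rabs_pos_eq; [| apply Rmult_le_pos; [nra | trivial]].
        rewrite -(Rmult_1_l (64 / _)). apply Rmult_le_compat; trivial; nra.
      + apply Rabs_le; lra.
    - replace (64 / INR k ^ 4 * INR k) with (64 / INR k ^ 3) by (field; lra).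
      apply (Rmult_le_reg_r (INR k ^ 3)); [apply pow_lt; lra |].
      replace (64 / INR k ^ 3 * INR k ^ 3) with 64 by (field; lra).
      assert (2 ^ 3 <= INR k ^ 3) by (apply pow_incr; lra). simpl in *; lra. }
  assert (T2 : Rabs (flat d 0 (window k x) *
   ((PI / INR k) * (INR k * sincos (PI / INR k) (INR k) (pred k) 1 x) * c
    + s ^ k * (- lam * sin (lam * (x - 3 / 2 * INR k))))) <= 4 + lam).
  { assert (F := flat_0_bound d (window k x) Hd).
    rewrite Rabs_mult (Rabs_pos_eq (flat _ _ _)); [| tauto].
    replace (PI / INR k * (INR k * sincos (PI / INR k) (INR k) (pred k) 1 x) * c) with
      (PI * (sincos (PI / INR k) (INR k) (pred k) 1 x * c)) by (field; lra).
    replace (s ^ k * (- lam * sin (lam * (x - 3 / 2 * INR k)))) with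
      (- lam * (s ^ k * sin (lam * (x - 3 / 2 * INR k)))) by ring.
    assert (U1 : Rabs (sincos (PI / INR k) (INR k) (pred k) 1 x * c) <= 1).
    { apply Rabs_mult_le_1; [apply sincos_le | apply Rabs_cos_le]. }
    assert (U2 : Rabs (s ^ k * sin (lam * (x - 3 / 2 * INR k))) <= 1).
    { apply Rabs_mult_le_1; [apply pow_le_1_abs, Rabs_sin_le | apply Rabs_sin_le]. }
    set (u1 := sincos _ _ _ _ _ * c) in *; set (u2 := s ^ k * sin _) in *.
    assert (U : Rabs (PI * u1 + - lam * u2) <= 4 + lam).
    { apply Rabs_le_between in U1; apply Rabs_le_between in U2.
      assert (- PI <= PI * u1 <= PI) by (split; nra).
      assert (- lam <= lam * u2 <= lam) by (split; nra).
      apply Rabs_le; lra. }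
    assert (0 <= Rabs (PI * u1 + - lam * u2)) by apply Rabs_pos. nra. }
  eapply Rle_trans; [apply Rabs_triang | lra].
- unfold bump, carrier.
  pose proof (is_derive_sincos (PI / INR k) (INR k) k 0 x) as D1.
  assert (D2 : is_derive (fun x => cos (lam * (x - 3 / 2 * INR k))) x
    (- lam * sin (lam * (x - 3 / 2 * INR k)))) by (auto_derive; trivial; unfold Rminus; ring).
  assert (D3 : is_derive (window k) x (3 * INR k - 2 * x)).
  { unfold window; auto_derive; trivial; ring. }
  pose proof (is_derive_comp (flat d 0) (window k) x _ _ (is_derive_flat d 0 _ Hd) D3) as D4.
  pose proof (is_derive_mult _ _ x _ _ D4 (is_derive_mult _ _ x _ _ D1 D2 Rmult_comm) Rmult_comm) as D5.
  match type of D5 with is_derive _ _ ?l => replace (_ + _) with l; [exact D5 |] end.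
  unfold plus, mult, scal; simpl; unfold mult; simpl.
  unfold sincos; fold s; fold c; simpl pred; simpl INR; ring.
Qed.
End Bump.

(** * Decay of the transform of a single bump *)

Definition cis (y : R) : C := Cexp (0, y).

Lemma cis_cos (y : R) : (cis y + cis (- y) = RtoC (2 * cos y))%C.
Proof.
unfold cis, Cexp, Re, Im; apply injective_projections; simpl;
rewrite exp_0 ?cos_neg ?sin_neg; ring.
Qed.

Lemma Cmod_Cexp_le (s : C) (R0 x b : R) : Cmod s <= R0 -> 0 <= x <= b ->
  Cmod (Cexp (- (s * RtoC x))) <= exp (R0 * b).
Proof.
intros Hs Hx; rewrite Cmod_Cexp; apply exp_le; simpl.
assert (H := re_le_Cmod s); apply Rabs_le_between in H; unfold Re in H.
assert (0 <= Cmod s) by apply Cmod_ge_0.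
assert (- fst s * x <= R0 * x) by (apply Rmult_le_compat_r; lra).
assert (R0 * x <= R0 * b) by (apply Rmult_le_compat_l; lra).
lra.
Qed.

(** With this [d], passing from [carrier] to [bump] costs at most [lam ^ - k],
    which is below the decay [(10 / lam) ^ k] of the transform of [carrier]. *)
Definition bump_d (k : nat) (lam : R) : R := / (8 * lam ^ k).

Lemma bump_d_pos (k : nat) (lam : R) : 1 <= lam -> 0 < bump_d k lam.
Proof.
intros Hlam; apply Rinv_0_lt_compat; assert (0 < lam ^ k) by (apply pow_lt; lra); lra.
Qed.

Section Transform.
Variables (k : nat) (lam A R0 : R) (s : C) (w : nat -> R -> C).
Hypothesis Hk : (2 <= k)%nat.
Hypothesis Hlam : 1 <= lam.
Hypothesis Hw : forall i x, is_Cder (w i) x (w (S i) x).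
Hypothesis HA : forall i x, INR k <= x <= 2 * INR k -> Cmod (w i x) <= A.
Hypothesis Hs : Cmod s <= R0.
Let d := bump_d k lam.
Let M := A * exp (R0 * (2 * INR k)).

Lemma cont_w0 x : continuous (U := CR) (w 0%nat) x.
Proof. eapply Cder_continuous, Hw. Qed.

(** The modulus of the exponential depends only on Re z, so the bound for s also serves the shifted
    points s + i lam and s - i lam. *)
Lemma wE_bound (z : C) i x : Re z = Re s -> INR k <= x <= 2 * INR k ->
  Cmod (w i x * Cexp (- (z * RtoC x)))%C <= M.
Proof.
intros Hz Hx; assert (K := INR_ge_2 k Hk).
rewrite Cmod_mult; apply Rmult_le_compat; try apply Cmod_ge_0; [now apply HA |].
replace (Cmod (Cexp (- (z * x)))) with (Cmod (Cexp (- (s * x)))).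
- apply Cmod_Cexp_le; trivial; lra.
- rewrite !Cmod_Cexp; f_equal; simpl; unfold Re in Hz; rewrite Hz; ring.
Qed.

Lemma weighted_ex (f : R -> R) :
  (forall x, continuous f x) ->
  ex_CInt (fun x => w 0%nat x * RtoC (f x) * Cexp (- (s * RtoC x)))%C (INR k) (2 * INR k).
Proof.
intros Hf; apply (ex_RInt_continuous (V := CR)); intros x _.
apply Ccont_mult; [apply Ccont_mult |].
- apply cont_w0.
- apply Ccont_pair; [apply Hf | apply: continuous_const].
- eapply Cder_continuous, Cder_Cexp.
Qed.

Lemma weighted_bound (f : R -> R) (e : R) :
  (forall x, continuous f x) ->
  (forall x, INR k <= x <= 2 * INR k -> Rabs (f x) <= e) ->
  Cmod (CInt (fun x => w 0%nat x * RtoC (f x) * Cexp (- (s * RtoC x)))%C (INR k) (2 * INR k))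
  <= M * e * INR k.
Proof.
intros Hf He; assert (K := INR_ge_2 k Hk).
replace (INR k) with (2 * INR k - INR k) at 3 by ring.
apply CInt_norm_le; [lra | now apply weighted_ex |].
intros x Hx.
replace (w 0%nat x * f x * Cexp (- (s * x)))%C with ((w 0%nat x * Cexp (- (s * x))) * f x)%C by ring.
rewrite Cmod_mult; apply Rmult_le_compat; try apply Cmod_ge_0.
- now apply wE_bound.
- rewrite Cmod_R; now apply He.
Qed.

(** Writing the cosine as a half-sum of exponentials moves s to s - i lam and s + i lam, both of
    modulus at least lam / 2 because |s| <= R0 <= lam / 2. Then [oscillation_bound] applies with k
    integrations by parts and th = pi / k. *)
Lemma carrier_transform_bound : 2 * R0 <= lam ->
  Cmod (CInt (fun x => w 0%nat x * RtoC (carrier k lam x) * Cexp (- (s * RtoC x)))%C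
     (INR k) (2 * INR k)) <= M * INR k * (10 / lam) ^ k.
Proof.
intros HR; assert (K := INR_ge_2 k Hk); assert (P := PI_RGT_0); assert (P4 := PI_4).
pose (u := (0, lam) : C).
set (th := PI / INR k).
assert (Hth : 0 <= th) by (apply Rdiv_le_0_compat; lra).
pose (F := fun x => (w 0%nat x * RtoC (sincos th (INR k) k 0 x))%C).
assert (HM0 : 0 <= M).
{ eapply Rle_trans; [apply Cmod_ge_0 |].
  apply (wE_bound s 0 (INR k)); [trivial | lra]. }
assert (Hu : Cmod u = lam).
{ unfold Cmod, u; simpl.
  replace (_ + _) with (lam ^ 2) by (simpl; ring). apply sqrt_pow2; lra. }
assert (HF : forall z, Re z = Re s -> lam / 2 <= Cmod z ->
  ex_CInt (fun x => F x * Cexp (- (z * RtoC x)))%C (INR k) (2 * INR k) /\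
  Cmod (CInt (fun x => F x * Cexp (- (z * RtoC x)))%C (INR k) (2 * INR k))
    <= M * INR k * (10 / lam) ^ k).
{ intros z Rz Hz; split.
  - apply (ex_RInt_continuous (V := CR)); intros x _.
    apply Ccont_mult; [apply Ccont_mult |].
    + apply cont_w0.
    + eapply Cder_continuous, Cder_RtoC, is_derive_sincos.
    + eapply Cder_continuous, Cder_Cexp.
  - eapply Rle_trans.
    + apply (oscillation_bound th (INR k) (2 * INR k) M z w Hw Hth); try lra.
      * replace (th * (2 * INR k - INR k)) with PI by (unfold th; field; lra). apply sin_PI.
      * apply Cmod_gt_0; lra.
      * intros i x Hx; now apply wE_bound.
      * apply Nat.add_0_r.
      * apply Nat.le_refl.
    + replace (INR k * th) with PI by (unfold th; field; lra).
      replace (2 * INR k - INR k) with (INR k) by ring.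
      apply Rmult_le_compat_l; [apply Rmult_le_pos; lra |].
      (* The constant 10 bounds 2 (1 + pi), with pi <= 4 and |z| >= lam / 2. *)
      apply pow_incr; split; [apply Rdiv_le_0_compat; lra |].
      apply (Rmult_le_reg_r (Cmod z * lam)); [apply Rmult_lt_0_compat; lra |].
      replace ((1 + PI) / Cmod z * (Cmod z * lam)) with ((1 + PI) * lam) by (field; lra).
      replace (10 / lam * (Cmod z * lam)) with (10 * Cmod z) by (field; lra).
      nra. }
assert (Z1 : lam / 2 <= Cmod (s - u)%C).
{ assert (T := Cmod_triangle (s - u)%C (- s)%C).
  replace (s - u + - s)%C with (- u)%C in T by ring.
  rewrite !Cmod_opp in T; lra. }
assert (Z2 : lam / 2 <= Cmod (s + u)%C).
{ assert (T := Cmod_triangle (s + u)%C (- s)%C).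
  replace (s + u + - s)%C with u in T by ring.
  rewrite !Cmod_opp in T; lra. }
destruct (HF (s - u)%C) as [E1 B1]; [simpl; unfold Re; ring | trivial |].
destruct (HF (s + u)%C) as [E2 B2]; [simpl; unfold Re; ring | trivial |].
pose (m := 3 / 2 * INR k).
(* The phases account for the cosine being centred at m, the middle of the support, and not at 0. *)
pose (c1 := (RtoC (1 / 2) * cis (- (lam * m)))%C).
pose (c2 := (RtoC (1 / 2) * cis (lam * m))%C).
assert (C1 : forall y, Cmod (RtoC (1 / 2) * cis y)%C = 1 / 2).
{ intros y; rewrite Cmod_mult /cis Cmod_Cexp Cmod_R /= exp_0 Rabs_pos_eq; lra. }
pose proof (is_RInt_plus (V := CR) _ _ _ _ _ _
  (CInt_Cmult _ _ _ c1 _ (RInt_correct (V := CR) _ _ _ E1))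
  (CInt_Cmult _ _ _ c2 _ (RInt_correct (V := CR) _ _ _ E2))) as I.
rewrite (is_RInt_unique (V := CR) _ _ _ (plus
   ((c1 * CInt (fun x => F x * Cexp (- ((s - u) * RtoC x))) (INR k) (2 * INR k))%C : CR)
   (c2 * CInt (fun x => F x * Cexp (- ((s + u) * RtoC x))) (INR k) (2 * INR k))%C)).
- eapply Rle_trans; [apply Cmod_triangle |].
  rewrite (Cmod_mult c1) (Cmod_mult c2).
  assert (N1 : Cmod c1 = 1 / 2) by apply C1; assert (N2 : Cmod c2 = 1 / 2) by apply C1.
  rewrite N1 N2; lra.
- revert I; apply (is_RInt_ext (V := CR)); intros x _.
  change (c1 * (F x * Cexp (- ((s - u) * x))) + c2 * (F x * Cexp (- ((s + u) * x))) =
    w 0%nat x * carrier k lam x * Cexp (- (s * x)))%C.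
  unfold carrier; fold th; fold m.
  assert (X1 : (cis (- (lam * m)) * Cexp (- ((s - u) * x)) =
     Cexp (- (s * x)) * cis (lam * (x - m)))%C).
  { unfold cis; rewrite -!Cexp_plus; f_equal; apply injective_projections; simpl; ring. }
  assert (X2 : (cis (lam * m) * Cexp (- ((s + u) * x)) =
     Cexp (- (s * x)) * cis (- (lam * (x - m))))%C).
  { unfold cis; rewrite -!Cexp_plus; f_equal; apply injective_projections; simpl; ring. }
  transitivity (RtoC (1 / 2) * F x * (cis (- (lam * m)) * Cexp (- ((s - u) * x)) +
    cis (lam * m) * Cexp (- ((s + u) * x))))%C; [unfold c1, c2; ring |].
  rewrite X1 X2 -Cmult_plus_distr_l cis_cos.
  replace (sincos th (INR k) k 0 x * cos (lam * (x - m))) with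
    (1 / 2 * sincos th (INR k) k 0 x * (2 * cos (lam * (x - m)))) by field.
  unfold F; rewrite !(RtoC_mult (_ * _)); change (1 * / 2) with (1 / 2); ring.
Qed.

(** No cancellation is used, hence no condition relating [R0] and [lam]. This serves the finitely
    many bumps whose frequency is still too small compared with |s|. *)
Lemma bump_transform_trivial_bound :
  Cmod (CInt (fun x => w 0%nat x * RtoC (bump k lam d x) * Cexp (- (s * RtoC x)))%C
     (INR k) (2 * INR k)) <= M * INR k.
Proof.
rewrite -(Rmult_1_r M); apply weighted_bound.
- intros x; now apply elementary_continuous, elementary_bump, bump_d_pos.
- intros x _; now apply bump_le, bump_d_pos.
Qed.

(** Split the bump into [carrier] and an error of size 8 d = lam^(-k) <= (10 / lam)^k. Only the
    carrier is integrated by parts, so higher derivatives of [flat] never have to be estimated. *)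
Lemma bump_transform_bound : 2 * R0 <= lam ->
  Cmod (CInt (fun x => w 0%nat x * RtoC (bump k lam d x) * Cexp (- (s * RtoC x)))%C
     (INR k) (2 * INR k)) <= 2 * (M * INR k * (10 / lam) ^ k).
Proof.
intros HR; assert (K := INR_ge_2 k Hk).
assert (HM0 : 0 <= M).
{ eapply Rle_trans; [apply Cmod_ge_0 |].
  apply (wE_bound s 0 (INR k)); [trivial | lra]. }
assert (Cb : forall x, continuous (bump k lam d) x).
{ intros x; now apply elementary_continuous, elementary_bump, bump_d_pos. }
assert (Cc : forall x, continuous (carrier k lam) x).
{ intros x; apply elementary_continuous, elementary_carrier. }
assert (Cd : forall x, continuous (fun x => bump k lam d x - carrier k lam x) x).
{ intros x; now apply: continuous_minus. }
pose proof (is_RInt_plus (V := CR) _ _ _ _ _ _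
  (RInt_correct (V := CR) _ _ _ (weighted_ex _ Cc))
  (RInt_correct (V := CR) _ _ _ (weighted_ex _ Cd))) as I.
simpl in I.
rewrite (is_RInt_unique (V := CR) _ _ _ (plus
  (CInt (fun x => w 0%nat x * RtoC (carrier k lam x) * Cexp (- (s * RtoC x)))%C (INR k) (2 * INR k))
  (CInt (fun x => w 0%nat x * RtoC (bump k lam d x - carrier k lam x) * Cexp (- (s * RtoC x)))%C
    (INR k) (2 * INR k)))).
- eapply Rle_trans; [apply Cmod_triangle |].
  assert (B1 := carrier_transform_bound HR).
  assert (B2 := weighted_bound _ (8 * d) Cd (bump_approx k lam d Hk (bump_d_pos k lam Hlam))).
  assert (D : 8 * d <= (10 / lam) ^ k).
  { assert (0 < lam ^ k) by (apply pow_lt; lra).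
    replace (8 * d) with ((1 / lam) ^ k).
    - apply pow_incr; split; [apply Rdiv_le_0_compat; lra |].
      apply Rmult_le_compat_r; [left; apply Rinv_0_lt_compat; lra | lra].
    - unfold d, bump_d, Rdiv; rewrite Rmult_1_l pow_inv; field; lra. }
  assert (M * (8 * d) * INR k <= M * INR k * (10 / lam) ^ k).
  { replace (M * (8 * d) * INR k) with (M * INR k * (8 * d)) by ring.
    apply Rmult_le_compat_l; trivial; apply Rmult_le_pos; lra. }
  lra.
- revert I; apply (is_RInt_ext (V := CR)); intros x _.
  apply injective_projections; simpl; unfold plus; simpl; ring.
Qed.
End Transform.

(** * Bump transforms and their Taylor remainders in s *)

Definition wone (i : nat) (x : R) : C := match i with O => RtoC 1 | S _ => RtoC 0 end.

Lemma Cder_wone i x : is_Cder (wone i) x (wone (S i) x).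
Proof. destruct i; apply Cder_const. Qed.

Lemma Cmod_wone i x : Cmod (wone i x) <= 1.
Proof. destruct i; simpl; rewrite ?Cmod_1 ?Cmod_0; lra. Qed.

(** The successive derivatives of the weight e^(-hx) - 1 + hx, which turns e^(-sx)
    into the second-order Taylor remainder of [s |-> e^(-sx)] (see
    [bump_weight_taylor]). *)
Definition wrem (h : C) (i : nat) (x : R) : C :=
  match i with
  | 0%nat => Cexp (- (h * RtoC x)) - 1 + h * RtoC x
  | 1%nat => - h * (Cexp (- (h * RtoC x)) - 1)
  | S (S j) => (- h) ^ S (S j) * Cexp (- (h * RtoC x))
  end%C.

Lemma Cder_id (x : R) : is_Cder (fun t => RtoC t) x (RtoC 1).
Proof. apply Cder_RtoC; apply: is_derive_id. Qed.

Lemma Cder_plus (f g : R -> C) (x : R) (f' g' : C) :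
  is_Cder f x f' -> is_Cder g x g' -> is_Cder (fun t => (f t + g t)%C) x (f' + g')%C.
Proof. intros Hf Hg; exact (is_derive_plus _ _ _ _ _ Hf Hg). Qed.

Lemma Cder_wrem h i x : is_Cder (wrem h i) x (wrem h (S i) x).
Proof.
assert (D1 : is_Cder (fun t => Cexp (- (h * RtoC t)) - 1)%C x (- h * Cexp (- (h * RtoC x)) + 0)%C).
{ apply (Cder_plus _ (fun _ => Copp (RtoC 1))); [apply Cder_Cexp | apply Cder_const]. }
destruct i as [|[|j]].
- eapply Cder_eq.
  + apply Cder_plus; [exact D1 |].
    apply Cder_mult; [apply Cder_const | apply Cder_id].
  + simpl; ring.
- eapply Cder_eq.
  + apply Cder_mult; [apply Cder_const | exact D1].
  + simpl; ring.
- eapply Cder_eq.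
  + apply Cder_mult; [apply Cder_const | apply Cder_Cexp].
  + unfold wrem; rewrite (Cpow_S _ (S (S j))); ring.
Qed.

(** Complex values admit no mean value equality, so f(x) is recovered as the integral of f' from
    0. *)
Lemma Cmod_le_of_derive (f f' : R -> C) (M x : R) :
  (forall t, is_Cder f t (f' t)) -> (forall t, continuous (U := CR) f' t) ->
  f 0 = RtoC 0 -> 0 <= x -> (forall t, 0 <= t <= x -> Cmod (f' t) <= M) ->
  Cmod (f x) <= M * x.
Proof.
intros Hf Hc H0 Hx HM.
pose proof (is_RInt_derive (V := CR) f f' 0 x (fun t _ => Hf t) (fun t _ => Hc t)) as I.
replace (f x) with (CInt f' 0 x).
- rewrite -{2}(Rminus_0_r x); apply CInt_norm_le; trivial; eexists; exact I.
- etransitivity; [exact (is_RInt_unique (V := CR) _ _ _ _ I) |].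
  rewrite H0; apply injective_projections; simpl; unfold minus, plus, opp; simpl;
  unfold plus, opp; simpl; ring.
Qed.

(** For i >= 2 the factor |h|^i is at most |h|^2. The cases i = 1 and i = 0 follow by integrating
    from 0, where these weights vanish, at the cost of a factor b each time. *)
Lemma Cmod_wrem h i x b : Cmod h <= 1 -> 1 <= b -> 0 <= x <= b ->
  Cmod (wrem h i x) <= Cmod h ^ 2 * b ^ 2 * exp b.
Proof.
intros Hh Hb Hx.
assert (H0 := Cmod_ge_0 h); assert (Eb := exp_pos b).
assert (HE : forall t, 0 <= t <= b -> Cmod (Cexp (- (h * RtoC t))) <= exp b).
{ intros t Ht; rewrite -(Rmult_1_l b); apply Cmod_Cexp_le; trivial; lra. }
assert (Hc : forall j t, continuous (U := CR) (wrem h j) t).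
{ intros j t; eapply Cder_continuous, Cder_wrem. }
assert (b2 : b <= b ^ 2) by nra.
assert (h2 : 0 <= Cmod h ^ 2) by apply pow2_ge_0.
assert (W2 : forall j t, 0 <= t <= b -> Cmod (wrem h (S (S j)) t) <= Cmod h ^ 2 * exp b).
{ intros j t Ht; unfold wrem; rewrite Cmod_mult Cmod_pow Cmod_opp.
  apply Rmult_le_compat; auto using Cmod_ge_0, pow_le.
  replace (S (S j)) with (2 + j)%nat by lia; rewrite pow_add.
  rewrite -{2}(Rmult_1_r (Cmod h ^ 2)); apply Rmult_le_compat_l; trivial.
  rewrite -(pow1 j); apply pow_incr; lra. }
assert (W1 : forall t, 0 <= t <= b -> Cmod (wrem h 1 t) <= Cmod h ^ 2 * exp b * b).
{ intros t Ht.
  apply Rle_trans with (Cmod h ^ 2 * exp b * t).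
  - apply (Cmod_le_of_derive _ (wrem h 2)); try tauto.
    + intros u; apply Cder_wrem.
    + apply Hc.
    + unfold wrem; rewrite Cexp_at_0; ring.
    + intros u Hu; apply W2; lra.
  - apply Rmult_le_compat_l; [nra | lra]. }
assert (P : 0 <= Cmod h ^ 2 * exp b) by nra.
destruct i as [|[|j]].
- apply Rle_trans with (Cmod h ^ 2 * exp b * b * x).
  + apply (Cmod_le_of_derive _ (wrem h 1)); try tauto.
    * intros u; apply Cder_wrem.
    * apply Hc.
    * unfold wrem; rewrite Cexp_at_0; ring.
    * intros u Hu; apply W1; lra.
  + replace (Cmod h ^ 2 * b ^ 2 * exp b) with (Cmod h ^ 2 * exp b * b * b) by ring.
    apply Rmult_le_compat_l; [nra | lra].
- eapply Rle_trans; [now apply W1 |].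
  replace (Cmod h ^ 2 * b ^ 2 * exp b) with (Cmod h ^ 2 * exp b * b ^ 2) by ring.
  now apply Rmult_le_compat_l.
- eapply Rle_trans; [now apply W2 |].
  replace (Cmod h ^ 2 * b ^ 2 * exp b) with (Cmod h ^ 2 * exp b * b ^ 2) by ring.
  nra.
Qed.

(** The weight 1 gives the Laplace transform of the bump, -x its derivative in s, and [wrem h 0] its
    second-order remainder. *)
Definition bump_weight (k : nat) (lam : R) (w : R -> C) (s : C) : C :=
  CInt (fun x => w x * RtoC (bump k lam (bump_d k lam) x) * Cexp (- (s * RtoC x)))%C
    (INR k) (2 * INR k).

Lemma bump_weight_taylor (k : nat) (lam : R) (s h : C) : 1 <= lam ->
  (bump_weight k lam (wone 0) (s + h) - bump_weight k lam (wone 0) s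
   - h * bump_weight k lam (fun x => - RtoC x) s)%C = bump_weight k lam (wrem h 0) s.
Proof.
intros Hlam; unfold bump_weight.
set (g := bump k lam (bump_d k lam)).
assert (Hg : forall x, continuous (U := CR) (fun t => RtoC (g t)) x).
{ intros x; apply Ccont_pair; [| apply: continuous_const].
  apply elementary_continuous, elementary_bump, bump_d_pos; trivial. }
assert (HE : forall z x, continuous (U := CR) (fun t => Cexp (- (z * RtoC t))%C) x).
{ intros z x; eapply Cder_continuous, Cder_Cexp. }
assert (Hi : forall (w : R -> C) z, (forall x, continuous (U := CR) w x) ->
  is_CInt (fun x => w x * RtoC (g x) * Cexp (- (z * RtoC x)))%C (INR k) (2 * INR k)
   (CInt (fun x => w x * RtoC (g x) * Cexp (- (z * RtoC x)))%C (INR k) (2 * INR k))).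
{ intros w z Hw; apply (RInt_correct (V := CR)), (ex_RInt_continuous (V := CR)).
  intros x _; apply Ccont_mult; trivial; now apply Ccont_mult. }
assert (C1 : forall x, continuous (U := CR) (wone 0) x) by (intros x; apply: continuous_const).
assert (Cx : forall x, continuous (U := CR) (fun x => - RtoC x)%C x).
{ intros x; apply: continuous_opp; eapply Cder_continuous, Cder_id. }
symmetry; apply (is_RInt_unique (V := CR)).
pose proof (is_RInt_minus (V := CR) _ _ _ _ _ _
  (is_RInt_minus (V := CR) _ _ _ _ _ _ (Hi (wone 0) (s + h)%C C1) (Hi (wone 0) s C1))
  (CInt_Cmult _ _ _ h _ (Hi (fun x => - RtoC x)%C s Cx))) as I.
revert I; apply (is_RInt_ext (V := CR)); intros x _.
change (wone 0 x * g x * Cexp (- ((s + h) * x)) - wone 0 x * g x * Cexp (- (s * x)) -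
  h * (- x * g x * Cexp (- (s * x))) = wrem h 0 x * g x * Cexp (- (s * x)))%C.
replace (- ((s + h) * x))%C with (- (s * x) + - (h * x))%C by ring.
rewrite Cexp_plus; simpl; ring.
Qed.

Section BumpBounds.
Variables (k : nat) (lam R0 : R) (s h : C).
Hypothesis Hk : (2 <= k)%nat.
Hypothesis Hlam : 1 <= lam.
Hypothesis Hs : Cmod s <= R0.
Hypothesis Hh : Cmod h <= 1.
(** Collects, at b = 2k, the factors b^2 e^b of [Cmod_wrem], the bound e^(2 R0 k) of the exponential
    and the length k of the support. The same value dominates the transform itself. *)
Let Q := 4 * INR k ^ 3 * exp (2 * (R0 + 1)) ^ k.

Lemma Q_bounds :
  exp (R0 * (2 * INR k)) * INR k <= Q /\
  Cmod h ^ 2 * (2 * INR k) ^ 2 * exp (2 * INR k) * exp (R0 * (2 * INR k)) * INR k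
    <= Q * Cmod h ^ 2.
Proof.
assert (K := INR_ge_2 k Hk).
assert (E : forall t j, exp t ^ j = exp (INR j * t)).
{ intros t; induction j as [|j IH].
  - rewrite Rmult_0_l exp_0; trivial.
  - rewrite S_INR /= IH -exp_plus; f_equal; ring. }
unfold Q; rewrite E.
assert (E1 : exp (R0 * (2 * INR k)) <= exp (INR k * (2 * (R0 + 1)))) by (apply exp_le; lra).
split.
- rewrite Rmult_comm.
  apply Rmult_le_compat; trivial; [lra | left; apply exp_pos |].
  assert (INR k <= INR k ^ 3) by (simpl; nra). nra.
- right.
  replace (INR k * (2 * (R0 + 1))) with (2 * INR k + R0 * (2 * INR k)) by ring.
  rewrite exp_plus; ring.
Qed.

Lemma bump_weight_trivial_bounds :
  Cmod (bump_weight k lam (wone 0) s) <= Q /\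
  Cmod (bump_weight k lam (wrem h 0) s) <= Q * Cmod h ^ 2.
Proof.
destruct Q_bounds as [Q1 Q2]; assert (K := INR_ge_2 k Hk); split.
- eapply Rle_trans; [| exact Q1].
  rewrite -(Rmult_1_l (exp _)).
  apply bump_transform_trivial_bound; trivial; intros; [apply Cder_wone | apply Cmod_wone].
- eapply Rle_trans; [| exact Q2].
  apply bump_transform_trivial_bound; trivial; intros; [apply Cder_wrem |].
  apply Cmod_wrem; trivial; lra.
Qed.

Lemma bump_weight_bounds : 2 * R0 <= lam ->
  Cmod (bump_weight k lam (wone 0) s) <= 2 * (Q * (10 / lam) ^ k) /\
  Cmod (bump_weight k lam (wrem h 0) s) <= 2 * (Q * (10 / lam) ^ k) * Cmod h ^ 2.
Proof.
intros HR; destruct Q_bounds as [Q1 Q2]; assert (K := INR_ge_2 k Hk).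
assert (P : 0 <= (10 / lam) ^ k) by (apply pow_le, Rdiv_le_0_compat; lra).
split.
- apply Rle_trans with (2 * (1 * exp (R0 * (2 * INR k)) * INR k * (10 / lam) ^ k)).
  + apply bump_transform_bound; trivial; intros; [apply Cder_wone | apply Cmod_wone].
  + rewrite Rmult_1_l; apply Rmult_le_compat_l; [lra |].
    now apply Rmult_le_compat_r.
- eapply Rle_trans.
  + apply (bump_transform_bound k lam (Cmod h ^ 2 * (2 * INR k) ^ 2 * exp (2 * INR k)) R0 s
      (wrem h)); trivial; intros; [apply Cder_wrem |].
    apply Cmod_wrem; trivial; lra.
  + replace (2 * (Q * (10 / lam) ^ k) * Cmod h ^ 2) with
      (2 * (Q * Cmod h ^ 2 * (10 / lam) ^ k)) by ring.
    apply Rmult_le_compat_l; [lra |].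
    now apply Rmult_le_compat_r.
Qed.
End BumpBounds.

Lemma INR_le_pow2 (n : nat) : INR n <= 2 ^ n.
Proof.
induction n as [|n IH]; [simpl; lra |].
assert (1 <= 2 ^ n) by (apply pow_R1_Rle; lra).
rewrite S_INR; simpl; lra.
Qed.

(** On the disc of radius R0, the terms with n < N get the trivial bound. From N on, the oscillatory
    bound is at most 8 k^3 (10 E0 / 2^n)^k, with E0 = e^(2 (R0 + 1)), and this is at most 8 /
    2^n. *)
Lemma bump_series_entire (k : nat -> nat) (c : nat -> R) :
  (forall n, (2 <= k n)%nat) -> (forall n, (n <= k n)%nat) -> (forall n, Rabs (c n) <= 1) ->
  exists G : C -> C, (forall z, quadratically_approx G z) /\
    forall s, is_Cseries (fun n => RtoC (c n) * bump_weight (k n) (2 ^ n) (wone 0) s)%C (G s).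
Proof.
intros Hk2 Hkn Hc.
assert (L1 : forall n, 1 <= 2 ^ n) by (intros n; apply pow_R1_Rle; lra).
apply (entire_series _
  (fun n s => RtoC (c n) * bump_weight (k n) (2 ^ n) (fun x => - RtoC x)%C s)%C).
intros R0.
pose (E0 := exp (2 * (R0 + 1))).
assert (E0p : 0 < E0) by apply exp_pos.
(* The first threshold is the hypothesis of [bump_weight_bounds]. The second makes 10 E0 / 2^n <= 1
   / 16, where 16 = 8 * 2: the 8^k pays for k^3 <= (2^k)^3 and (1 / 2)^k is left over. *)
destruct (Pow_x_infinity 2 ltac:(rewrite Rabs_pos_eq; lra) (Rmax (2 * R0) (160 * E0))) as [N HN].
pose (Q := fun n => 4 * INR (k n) ^ 3 * E0 ^ k n).
pose (B := fun n => if Nat.ltb n N then Q n else 8 * (1 / 2) ^ n).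
exists B; split.
- apply (ex_series_incr_n _ N).
  apply (ex_series_ext (fun j => 8 * (1 / 2) ^ N * (1 / 2) ^ j)).
  + intros j; unfold B; destruct (Nat.ltb_spec (N + j) N); [lia |].
    rewrite pow_add; apply Rmult_assoc.
  + apply: ex_series_scal; apply ex_series_geom; rewrite Rabs_pos_eq; lra.
- intros n s h Hs Hh.
  replace (RtoC (c n) * bump_weight (k n) (2 ^ n) (wone 0) (s + h) -
    RtoC (c n) * bump_weight (k n) (2 ^ n) (wone 0) s -
    h * (RtoC (c n) * bump_weight (k n) (2 ^ n) (fun x => - RtoC x) s))%C with
    (RtoC (c n) * bump_weight (k n) (2 ^ n) (wrem h 0) s)%C.
  2: { rewrite -bump_weight_taylor; [ring | apply L1]. }
  assert (B' : Cmod (bump_weight (k n) (2 ^ n) (wone 0) s) <= B n /\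
    Cmod (bump_weight (k n) (2 ^ n) (wrem h 0) s) <= B n * Cmod h ^ 2).
  { unfold B; destruct (Nat.ltb_spec n N) as [HnN | HnN].
    - now apply bump_weight_trivial_bounds.
    - assert (HL := HN n HnN); rewrite Rabs_pos_eq in HL; [| specialize (L1 n); lra].
      assert (HL1 := Rmax_l (2 * R0) (160 * E0)); assert (HL2 := Rmax_r (2 * R0) (160 * E0)).
      destruct (bump_weight_bounds (k n) (2 ^ n) R0 s h) as [B1 B2]; trivial; [lra |].
      fold E0 in B1, B2; fold (Q n) in B1, B2.
      assert (HQ : 2 * (Q n * (10 / 2 ^ n) ^ k n) <= 8 * (1 / 2) ^ n).
      { unfold Q.
        replace (2 * (4 * INR (k n) ^ 3 * E0 ^ k n * (10 / 2 ^ n) ^ k n)) with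
          (8 * (INR (k n) ^ 3 * (10 * E0 / 2 ^ n) ^ k n)).
        2: { replace (10 * E0 / 2 ^ n) with (E0 * (10 / 2 ^ n)) by (unfold Rdiv; ring).
             rewrite Rpow_mult_distr; ring. }
        apply Rmult_le_compat_l; [lra |].
        assert (Hq : 0 <= 10 * E0 / 2 ^ n <= 1 / 16).
        { specialize (L1 n); split; [apply Rdiv_le_0_compat; lra |].
          apply (Rmult_le_reg_r (2 ^ n)); [lra |].
          replace (10 * E0 / 2 ^ n * 2 ^ n) with (10 * E0) by (field; lra). lra. }
        apply Rle_trans with ((2 ^ k n) ^ 3 * (1 / 16) ^ k n).
        - apply Rmult_le_compat; [apply pow_le, pos_INR | apply pow_le; tauto | |].
          + apply pow_incr; split; [apply pos_INR | apply INR_le_pow2].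
          + now apply pow_incr.
        - rewrite -pow_mult Nat.mul_comm pow_mult -Rpow_mult_distr.
          replace (2 ^ 3 * (1 / 16)) with (1 / 2) by field.
          (* As n <= k n, the surplus powers of 1 / 2 are dropped. *)
          replace (k n) with (n + (k n - n))%nat by (specialize (Hkn n); lia).
          rewrite pow_add -{2}(Rmult_1_r ((1 / 2) ^ n)).
          apply Rmult_le_compat_l; [apply pow_le; lra |].
          assert (P := pow_incr (1 / 2) 1 (k n - n)); rewrite pow1 in P; apply P; lra. }
      split; [lra |].
      eapply Rle_trans; [exact B2 |]; apply Rmult_le_compat_r; trivial; apply pow2_ge_0. }
  specialize (Hc n); assert (Hc0 := Rabs_pos (c n)).
  rewrite !Cmod_mult Cmod_R; destruct B' as [B1 B2].
  assert (M1 := Cmod_ge_0 (bump_weight (k n) (2 ^ n) (wone 0) s)).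
  assert (M2 := Cmod_ge_0 (bump_weight (k n) (2 ^ n) (wrem h 0) s)).
  split; [nra |].
  eapply Rle_trans; [| exact B2]; nra.
Qed.
(** * The oscillating function and its Laplace transform *)

Section Tau.
Variable k : nat -> nat.
Hypothesis Hk2 : forall n, (2 <= k n)%nat.
Hypothesis Hgrow : forall n, (2 * k n <= k (S n))%nat.

Definition coef (n : nat) : R := (-1) ^ n * (1 / 4) ^ n.

Definition term (n : nat) (x : R) : R :=
  coef n * bump (k n) (2 ^ n) (bump_d (k n) (2 ^ n)) x.

(** A finite sum at each point: as k n >= n, the terms of index beyond [up x] vanish at x. For
    negative x only term 0 is left, and it vanishes as well. *)
Definition tau (x : R) : R := sum_n (fun n => term n x) (Z.to_nat (up x)).

Lemma Rabs_coef n : Rabs (coef n) = (1 / 4) ^ n.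
Proof.
unfold coef; rewrite Rabs_mult pow_1_abs Rmult_1_l; apply Rabs_pos_eq, pow_le; lra.
Qed.

Lemma pow2_ge_1 n : 1 <= 2 ^ n.
Proof. apply pow_R1_Rle; lra. Qed.

Lemma bump_d_le n : bump_d (k n) (2 ^ n) <= 1 / 2.
Proof.
assert (H : 1 <= (2 ^ n) ^ k n) by apply pow_R1_Rle, pow2_ge_1.
unfold bump_d; replace (1 / 2) with (/ 2) by field; apply Rinv_le_contravar; lra.
Qed.

Lemma k_double i j : (i < j)%nat -> (2 * k i <= k j)%nat.
Proof.
induction 1 as [|j _ IH]; [apply Hgrow |].
assert (H := Hgrow j); lia.
Qed.

Lemma k_ge n : (n <= k n)%nat.
Proof.
induction n as [|n IH]; [lia |]; assert (H := Hgrow n); assert (H2 := Hk2 n); lia.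
Qed.

Lemma INR_k_double i j : (i < j)%nat -> 2 * INR (k i) <= INR (k j).
Proof. intros H; apply k_double, le_INR in H; rewrite mult_INR in H; exact H. Qed.

Lemma term_out n x : x <= INR (k n) \/ 2 * INR (k n) <= x -> term n x = 0.
Proof. intros H; unfold term; rewrite bump_out; [ring | trivial]. Qed.

Lemma sum_term_stable x N M : x <= INR (k (S N)) -> (N <= M)%nat ->
  sum_n (fun n => term n x) M = sum_n (fun n => term n x) N.
Proof.
intros Hx; induction 1 as [|M HM IH]; trivial.
rewrite sum_Sn IH term_out; [apply Rplus_0_r |].
left; apply Rle_trans with (1 := Hx).
destruct (Nat.eq_dec (S N) (S M)) as [-> | H]; [lra |].
assert (H1 := INR_k_double (S N) (S M) ltac:(lia)); assert (H2 := pos_INR (k (S N))); lra.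
Qed.

Lemma tau_eq x N : x <= INR (k (S N)) -> tau x = sum_n (fun n => term n x) N.
Proof.
intros Hx; unfold tau; set (M := Z.to_nat (up x)).
assert (HM : x <= INR (k (S M))).
{ assert (H1 : INR M <= INR (k (S M))) by (apply le_INR; assert (H := k_ge (S M)); lia).
  apply Rle_trans with (2 := H1).
  destruct (archimed x) as [H2 _]; apply Rlt_le, Rlt_le_trans with (1 := H2).
  unfold M; rewrite INR_IZR_INZ; apply IZR_le; lia. }
(* Both truncations extend to the common index M + N without changing the sum. *)
rewrite -(sum_term_stable x M (M + N) HM); [| lia].
apply sum_term_stable; trivial; lia.
Qed.

Lemma exists_k_gt (X : R) : exists N, forall n, (N <= n)%nat -> X < INR (k n).
Proof.
destruct (INR_unbounded X) as [N HN]; exists N; intros n Hn.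
apply Rlt_le_trans with (1 := HN), le_INR; assert (H := k_ge n); lia.
Qed.

(** The truncation index in [tau] depends on the point. Fixing it on a neighbourhood lets smoothness
    and derivatives pass from finite sums to [tau]. *)
Lemma tau_local x : exists N, locally x (fun y => sum_n (fun n => term n y) N = tau y).
Proof.
destruct (exists_k_gt x) as [N HN]; exists N.
apply (filter_imp (fun y => y < INR (k (S N)))).
- intros y Hy; symmetry; apply tau_eq; lra.
- apply (open_lt _); apply HN; lia.
Qed.

Lemma elementary_term n : elementary (term n).
Proof.
apply (elementary_mult (fun _ => coef n)); [constructor |].
apply elementary_bump, bump_d_pos, pow2_ge_1.
Qed.

Lemma tau_smooth n x : ex_derive_n tau n x.
Proof.
destruct (tau_local x) as [N HN].
apply (ex_derive_n_ext_loc _ _ n x HN).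
assert (E : exists g, elementary g /\ forall y, g y = sum_n (fun n => term n y) N).
{ clear HN; induction N as [|N (g & Hg & E)].
  - exists (term 0); split; [apply elementary_term |]; intros y; now rewrite sum_O.
  - exists (fun y => g y + term (S N) y); split.
    + now apply elementary_plus, elementary_term.
    + intros y; now rewrite sum_Sn E. }
destruct E as (g & Hg & E).
apply (ex_derive_n_ext g); trivial; now apply elementary_smooth.
Qed.

Lemma sum_half N : sum_n (fun n => (1 / 2) ^ n) N <= 2.
Proof.
assert (E : sum_n (fun n => (1 / 2) ^ n) N = 2 - (1 / 2) ^ N).
{ induction N as [|N IH]; [rewrite sum_O; simpl; lra |].
  rewrite sum_Sn IH; unfold plus; simpl; lra. }
rewrite E; assert (0 <= (1 / 2) ^ N) by (apply pow_le; lra); lra.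
Qed.

(** The 13 comes from the derivative of the n-th term, at most 4^(-n) (12 + 2^n) <= 13 * 2^(-n): one
    factor 2^(-n) pays for the frequency and the other is summed. *)
Lemma sum_bound (a : nat -> R) (N : nat) :
  (forall n, Rabs (a n) <= 13 * (1 / 2) ^ n) -> Rabs (sum_n a N) <= 26.
Proof.
intros Ha.
assert (E : Rabs (sum_n a N) <= 13 * sum_n (fun n => (1 / 2) ^ n) N).
{ induction N as [|N IH]; [rewrite !sum_O; apply Ha |].
  rewrite !sum_Sn; unfold plus; simpl.
  eapply Rle_trans; [apply Rabs_triang |]; specialize (Ha (S N)); simpl in Ha; lra. }
assert (H := sum_half N); lra.
Qed.

Lemma pow_quarter n : (1 / 4) ^ n = (1 / 2) ^ n * (1 / 2) ^ n.
Proof. rewrite -Rpow_mult_distr; f_equal; field. Qed.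

Lemma half_pow_bounds n : 0 < (1 / 2) ^ n <= 1.
Proof.
split; [apply pow_lt; lra |].
assert (P := pow_incr (1 / 2) 1 n); rewrite pow1 in P; apply P; lra.
Qed.

Lemma tau_bound x : Rabs (tau x) <= 26.
Proof.
apply sum_bound; intros n; unfold term; rewrite Rabs_mult Rabs_coef pow_quarter.
assert (B := bump_le (k n) (2 ^ n) _ x (bump_d_pos (k n) _ (pow2_ge_1 n))).
assert (H := half_pow_bounds n).
set (b := Rabs (bump _ _ _ _)) in *; assert (0 <= b) by apply Rabs_pos.
set (q := (1 / 2) ^ n) in *; assert (q * q <= q) by nra. nra.
Qed.

Lemma ex_derive_term n x : ex_derive (term n) x.
Proof.
destruct (elementary_derive _ (elementary_term n)) as (g & _ & D); now exists (g x).
Qed.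

Lemma derive_tau_bound x : Rabs (Derive tau x) <= 26.
Proof.
destruct (tau_local x) as [N HN].
rewrite -(Derive_ext_loc _ _ x HN).
rewrite (is_derive_unique _ _ (sum_n (fun n => Derive (term n) x) N)).
- apply sum_bound; intros n.
  assert (E : Derive (term n) x =
    coef n * Derive (bump (k n) (2 ^ n) (bump_d (k n) (2 ^ n))) x) by apply Derive_scal.
  rewrite E Rabs_mult Rabs_coef pow_quarter.
  assert (B := bump_derive_le (k n) (2 ^ n) _ (Hk2 n) (bump_d_pos (k n) _ (pow2_ge_1 n)) x).
  assert (L := pow2_ge_1 n); assert (D := bump_d_le n).
  assert (B' := B ltac:(lra) ltac:(lra)); clear B.
  assert (H := half_pow_bounds n).
  assert (U : (1 / 2) ^ n * 2 ^ n = 1).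
  { rewrite -Rpow_mult_distr; replace (1 / 2 * 2) with 1 by field; apply pow1. }
  set (b := Rabs (Derive _ _)) in *.
  set (q := (1 / 2) ^ n) in *; set (l := 2 ^ n) in *.
  rewrite Rmult_assoc (Rmult_comm 13); apply Rmult_le_compat_l; [lra |].
  apply Rle_trans with (q * (12 + l)); [apply Rmult_le_compat_l; lra |]. nra.
- apply: is_derive_sum_n; intros n _; apply Derive_correct, ex_derive_term.
Qed.

(** Every bump starts at some k n >= 2. The lower limit of the Laplace integral is therefore
    harmless, and [tilt] takes the value 1 at 0. *)
Lemma tau_zero x : x <= 2 -> tau x = 0.
Proof.
intros Hx; unfold tau.
induction (Z.to_nat (up x)) as [|N IH]; rewrite ?sum_O ?sum_Sn ?IH term_out;
try (left; apply Rle_trans with (1 := Hx); apply (le_INR 2), Hk2); trivial.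
apply Rplus_0_r.
Qed.

(** Earlier bumps have ended by k n and later ones start at 2 k n or beyond, so only one term
    survives at a centre. *)
Lemma tau_mid n : tau (3 / 2 * INR (k n)) = term n (3 / 2 * INR (k n)).
Proof.
assert (K := INR_ge_2 (k n) (Hk2 n)).
assert (H1 := INR_k_double n (S n) (Nat.lt_succ_diag_r n)).
rewrite (tau_eq _ n); [| lra].
assert (Z : forall j, (j < n)%nat -> term j (3 / 2 * INR (k n)) = 0).
{ intros j Hj; apply term_out; right; apply INR_k_double in Hj; lra. }
destruct n as [|n]; [apply sum_O |].
rewrite sum_Sn (sum_n_ext_loc _ (fun _ => 0)).
- rewrite sum_n_const Rmult_0_r; apply Rplus_0_l.
- intros j Hj; apply Z; lia.
Qed.

(** At the centre of the n-th bump |tau| >= 4^(-n) / 2 > rho, so c = 1 works; even n give the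
    positive values and odd n the negative ones. *)
Lemma tau_oscillates (rho : R -> R) :
  (forall n x, INR (k n) <= x -> rho x < (1 / 4) ^ n / 2) ->
  Omega_pm tau rho.
Proof.
intros Hrho; exists 1; split; [lra |].
assert (B : forall n, 1 / 2 <= bump (k n) (2 ^ n) (bump_d (k n) (2 ^ n)) (3 / 2 * INR (k n))).
{ intros n; apply bump_mid; [apply Hk2 | apply bump_d_pos, pow2_ge_1 | apply bump_d_le]. }
assert (M : forall n, INR (k n) <= 3 / 2 * INR (k n)).
{ intros n; assert (H := pos_INR (k n)); lra. }
assert (Q : forall n, 0 < (1 / 4) ^ n) by (intros n; apply pow_lt; lra).
split; intros X; destruct (exists_k_gt X) as [N HN].
- exists (3 / 2 * INR (k (2 * N)%nat)); split.
  + apply Rlt_le_trans with (2 := M _), HN; lia.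
  + rewrite tau_mid; unfold term, coef; rewrite pow_1_even.
    specialize (Hrho _ _ (M (2 * N)%nat)); specialize (B (2 * N)%nat); specialize (Q (2 * N)%nat).
    nra.
- exists (3 / 2 * INR (k (S (2 * N)))); split.
  + apply Rlt_le_trans with (2 := M _), HN; lia.
  + rewrite tau_mid; unfold term, coef; rewrite pow_1_odd.
    specialize (Hrho _ _ (M (S (2 * N)))); specialize (B (S (2 * N))); specialize (Q (S (2 * N))).
    nra.
Qed.
End Tau.

(** * Convergence of the Laplace transform of [tau] *)

Lemma Cseries_cv (a : nat -> C) (l : C) (eps : R) : is_Cseries a l -> 0 < eps ->
  exists N, forall n, (N <= n)%nat -> Cmod (sum_n (G := C_NormedModule) a n - l)%C < eps.
Proof.
intros Ha He.
assert (L : locally (T := C_NormedModule) l (fun y => Cmod (y - l)%C < eps)).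
{ apply (locally_le_locally_norm (V := C_NormedModule)).
  now exists (mkposreal _ He). }
destruct (Ha _ L) as [N HN]; now exists N.
Qed.

Lemma exp_decay (sg c e : R) : 0 < sg -> 0 < c -> 0 < e ->
  exists T0, forall T, T0 < T -> c * exp (- (sg * T)) < e.
Proof.
intros Hs Hc He.
assert (H : 0 < e / c) by now apply Rdiv_lt_0_compat.
exists (- ln (e / c) / sg); intros T A.
apply (Rmult_lt_compat_l sg) in A; trivial.
replace (sg * (- ln (e / c) / sg)) with (- ln (e / c)) in A by (field; lra).
assert (A2 : exp (- (sg * T)) < e / c) by (rewrite -(exp_ln _ H); apply exp_increasing; lra).
apply (Rmult_lt_compat_l c) in A2; trivial.
replace (c * (e / c)) with e in A2 by (field; lra); exact A2.
Qed.

Section LaplaceTau.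
Variable k : nat -> nat.
Hypothesis Hk2 : forall n, (2 <= k n)%nat.
Hypothesis Hgrow : forall n, (2 * k n <= k (S n))%nat.

Let f (s : C) (x : R) : C := (RtoC (tau k x) * Cexp (- (s * RtoC x)))%C.

Lemma continuous_tau x : continuous (tau k) x.
Proof. apply: ex_derive_continuous; exact (tau_smooth k Hk2 Hgrow 1 x). Qed.

Lemma ex_Laplace_int s a b : ex_CInt (f s) a b.
Proof.
apply (ex_RInt_continuous (V := CR)); intros x _; apply Ccont_mult.
- apply Ccont_pair; [apply continuous_tau | apply: continuous_const].
- eapply Cder_continuous, Cder_Cexp.
Qed.

Lemma term_transform n s T : 2 * INR (k n) <= T ->
  is_CInt (fun x => RtoC (term k n x) * Cexp (- (s * RtoC x)))%C 0 T
    (RtoC (coef n) * bump_weight (k n) (2 ^ n) (wone 0) s)%C.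
Proof.
intros HT; assert (K := INR_ge_2 (k n) (Hk2 n)).
assert (Z : forall x, x <= INR (k n) \/ 2 * INR (k n) <= x ->
  (RtoC (term k n x) * Cexp (- (s * RtoC x)))%C = RtoC 0).
{ intros x Hx; rewrite term_out //; apply Cmult_0_l. }
replace (RtoC (coef n) * bump_weight (k n) (2 ^ n) (wone 0) s)%C with
  (plus (plus (RtoC 0 : CR) (RtoC (coef n) * bump_weight (k n) (2 ^ n) (wone 0) s)%C) (RtoC 0)).
2: { etransitivity; [apply (plus_zero_r (G := CR)) | apply (plus_zero_l (G := CR))]. }
apply (is_RInt_Chasles (V := CR)) with (2 * INR (k n));
  [apply (is_RInt_Chasles (V := CR)) with (INR (k n)) |].
- apply CInt_zero; intros x Hx; apply Z; left; rewrite Rmax_right in Hx; lra.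
- apply (is_RInt_ext (V := CR) (fun x => RtoC (coef n) * (wone 0 x *
    RtoC (bump (k n) (2 ^ n) (bump_d (k n) (2 ^ n)) x) * Cexp (- (s * RtoC x))))%C).
  + intros x _; unfold term; simpl; rewrite RtoC_mult; ring.
  + apply CInt_Cmult, (RInt_correct (V := CR)).
    apply (weighted_ex (k n) s wone Cder_wone).
    intros x; apply elementary_continuous, elementary_bump, bump_d_pos, pow2_ge_1.
- apply CInt_zero; intros x Hx; apply Z; right; rewrite Rmin_left in Hx; lra.
Qed.

(** The point k (N + 1) lies between two supports, so the truncated integral contains whole bumps
    only and equals a partial sum of the series exactly. *)
Lemma Laplace_partial s N :
  CInt (f s) 0 (INR (k (S N))) = sum_n (G := C_NormedModule)
    (fun n => RtoC (coef n) * bump_weight (k n) (2 ^ n) (wone 0) s)%C N.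
Proof.
apply (is_RInt_unique (V := CR)).
set (T := INR (k (S N))).
apply (is_RInt_ext (V := CR)
  (fun x => RtoC (sum_n (fun n => term k n x) N) * Cexp (- (s * RtoC x)))%C).
{ intros x Hx; unfold f; rewrite (tau_eq k Hk2 Hgrow x N) //.
  rewrite Rmax_right in Hx; [fold T; lra | apply pos_INR]. }
assert (HT : forall n, (n <= N)%nat -> 2 * INR (k n) <= T).
{ intros n Hn; apply INR_k_double; trivial; lia. }
(* The upper limit is generalized first, so that it stays fixed while N varies. *)
clearbody T; induction N as [|N IH].
- rewrite sum_O.
  apply (is_RInt_ext (V := CR) (fun x => RtoC (term k 0 x) * Cexp (- (s * RtoC x)))%C).
  + intros x _; now rewrite sum_O.
  + apply term_transform, HT; lia.
- rewrite sum_Sn.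
  pose proof (is_RInt_plus (V := CR) _ _ _ _ _ _
    (IH (fun n Hn => HT n (Nat.le_trans _ _ _ Hn (Nat.le_succ_diag_r N))))
    (term_transform (S N) s T (HT (S N) (Nat.le_refl _)))) as I.
  revert I; apply (is_RInt_ext (V := CR)); intros x _; rewrite sum_Sn.
  unfold plus at 2; simpl; rewrite RtoC_plus.
  apply injective_projections; simpl; unfold plus; simpl; ring.
Qed.

Lemma Laplace_tail s a b : 0 < Re s -> a <= b ->
  Cmod (CInt (f s) a b) <= 26 / Re s * exp (- (Re s * a)).
Proof.
intros Hs Hab.
assert (I : is_RInt (fun x => 26 * exp (- (Re s * x))) a b
  (minus (- (26 / Re s) * exp (- (Re s * b))) (- (26 / Re s) * exp (- (Re s * a))))).
{ apply (is_RInt_derive (fun x => - (26 / Re s) * exp (- (Re s * x)))).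
  - intros x _; auto_derive; trivial; field; lra.
  - intros x _; apply (ex_derive_continuous (fun x => 26 * exp (- (Re s * x)))); auto_derive; trivial. }
apply Rle_trans with (minus (- (26 / Re s) * exp (- (Re s * b))) (- (26 / Re s) * exp (- (Re s * a)))).
- rewrite -norm_CR.
  apply (norm_RInt_le (V := C_R_NormedModule) (f s) (fun x => 26 * exp (- (Re s * x))) a b); trivial.
  + intros x Hx; rewrite norm_CR /f Cmod_mult Cmod_R Cmod_Cexp.
    apply Rmult_le_compat; [apply Rabs_pos | left; apply exp_pos | now apply tau_bound |].
    right; f_equal; simpl; unfold Re; ring.
  + apply (RInt_correct (V := CR)), ex_Laplace_int.
- unfold minus, plus, opp; simpl.
  assert (0 < 26 / Re s) by (apply Rdiv_lt_0_compat; lra).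
  assert (E := exp_pos (- (Re s * b))).
  nra.
Qed.

(** A general T may cut a bump. It is compared with a later point k (N + 1), where the partial sum
    is within eps / 2 of l; the piece in between is exponentially small in T since [tau] is
    bounded. *)
Lemma Laplace_tau_limit s l eps : 0 < Re s -> 0 < eps ->
  is_Cseries (fun n => RtoC (coef n) * bump_weight (k n) (2 ^ n) (wone 0) s)%C l ->
  exists T0, forall T, T0 < T -> Cmod (CInt (f s) 0 T - l)%C < eps.
Proof.
intros Hs He Hl.
destruct (Cseries_cv _ _ (eps / 2) Hl) as [N1 HN1]; [lra |].
pose (c := 26 / Re s).
assert (Hc : 0 < c) by (apply Rdiv_lt_0_compat; lra).
destruct (exp_decay (Re s) c (eps / 2) Hs Hc) as [T0 Hexp]; [lra |].
exists T0; intros T HT.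
destruct (exists_k_gt k Hk2 Hgrow T) as [N2 HN2].
pose (N := (N1 + N2)%nat).
assert (L1 : T < INR (k (S N))) by (apply HN2; lia).
assert (L2 : Cmod (CInt (f s) 0 (INR (k (S N))) - l)%C < eps / 2).
{ rewrite Laplace_partial; apply HN1; lia. }
assert (L3 := Laplace_tail s T (INR (k (S N))) Hs (Rlt_le _ _ L1)); fold c in L3.
assert (L4 := Hexp T HT).
assert (E : (CInt (f s) 0 (INR (k (S N))) = CInt (f s) 0 T + CInt (f s) T (INR (k (S N))))%C).
{ symmetry; exact (RInt_Chasles (V := CR) (f s) 0 T _ (ex_Laplace_int s _ _) (ex_Laplace_int s _ _)). }
rewrite E in L2.
set (I1 := CInt (f s) 0 T) in *; set (I2 := CInt (f s) T _) in *.
replace (I1 - l)%C with ((I1 + I2 - l) + - I2)%C by ring.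
eapply Rle_lt_trans; [apply Cmod_triangle | rewrite Cmod_opp; lra].
Qed.

Lemma is_Laplace_tau s l : 0 < Re s ->
  is_Cseries (fun n => RtoC (coef n) * bump_weight (k n) (2 ^ n) (wone 0) s)%C l ->
  is_Laplace (tau k) s l.
Proof.
intros Hs Hl P [eps HP].
destruct (Laplace_tau_limit s l eps Hs (cond_pos eps) Hl) as [T0 HT0].
apply (Filter_prod _ _ _ (fun e => 0 < e < 1) (fun T => T0 < T)).
- exists (mkposreal 1 Rlt_0_1); intros e He He0; split; trivial.
  apply Rabs_def2 in He; unfold minus, plus, opp in He; simpl in He; lra.
- now exists T0.
- intros e T He HT; exists (CInt (f s) 0 T); split.
  + simpl.
    (* As [tau] vanishes up to 2, moving the lower limit from e to 0 changes nothing. *)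
    assert (Z : is_CInt (f s) e 0 (RtoC 0)).
    { apply CInt_zero; intros x Hx; unfold f; rewrite tau_zero //; [apply Cmult_0_l |].
      rewrite Rmax_left in Hx; lra. }
    pose proof (is_RInt_Chasles (V := CR) _ _ _ _ _ _ Z
      (RInt_correct (V := CR) _ _ _ (ex_Laplace_int s 0 T))) as I.
    rewrite plus_zero_l in I; exact I.
  + apply HP, C_NormedModule_mixin_compat1, HT0, HT.
Qed.
End LaplaceTau.
(** * Riemann-Stieltjes integrals against a continuously differentiable function *)

Lemma subdiv_head_le_last (ptd : SF_seq) : pointed_subdiv ptd ->
  SF_h ptd <= seq.last (SF_h ptd) (SF_lx ptd).
Proof.
induction ptd as [x0 | h s IH] using SF_cons_ind; intros Hp; [simpl; lra |].
assert (H := Hp 0%nat ltac:(rewrite SF_size_cons; lia)); simpl in H.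
specialize (IH (ptd_cons _ _ Hp)); simpl in *; lra.
Qed.

Lemma RS_sum_cons {V : ModuleSpace R_Ring} (f : R -> V) (g : R -> R) h s :
  RS_sum f g (SF_cons h s) = plus (scal (g (SF_h s) - g (fst h)) (f (snd h))) (RS_sum f g s).
Proof. unfold RS_sum; simpl; destruct (SF_t s); reflexivity. Qed.

(** On each subinterval the two sums differ by (g y - g x - (y - x) g'(xi)) f(xi), of norm at most e
    (y - x) B, and the lengths telescope. *)
Lemma RS_sum_near {V : NormedModule R_AbsRing} (f : R -> V) (g g' : R -> R)
  (a b B e delta : R) :
  0 <= e -> (forall x, a <= x <= b -> norm (f x) <= B) ->
  (forall x xi y, a <= x <= xi -> xi <= y <= b -> y - x <= delta ->
     Rabs (g y - g x - (y - x) * g' xi) <= e * (y - x)) ->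
  forall ptd, pointed_subdiv ptd -> a <= SF_h ptd ->
  seq.last (SF_h ptd) (SF_lx ptd) <= b -> seq_step (SF_lx ptd) <= delta ->
  norm (minus (RS_sum f g ptd) (Riemann_sum (fun x => scal (g' x) (f x)) ptd))
  <= B * e * (seq.last (SF_h ptd) (SF_lx ptd) - SF_h ptd).
Proof.
intros He HB Hg ptd; induction ptd as [x0 | h s IH] using SF_cons_ind; intros Hp Ha Hb Hd.
- unfold RS_sum, Riemann_sum; simpl; rewrite minus_eq_zero norm_zero; lra.
- assert (H := Hp 0%nat ltac:(rewrite SF_size_cons; lia)); simpl in H.
  assert (Hl := subdiv_head_le_last s (ptd_cons _ _ Hp)); simpl in Hl.
  assert (Hd' : Rmax (Rabs (SF_h s - fst h)) (seq_step (SF_lx s)) <= delta) by exact Hd.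
  assert (Hd1 := Rle_trans _ _ _ (Rmax_l _ _) Hd').
  assert (Hd2 := Rle_trans _ _ _ (Rmax_r _ _) Hd').
  rewrite Rabs_pos_eq in Hd1; [| lra].
  simpl in Ha, Hb |- *.
  specialize (IH (ptd_cons _ _ Hp) ltac:(lra) Hb Hd2).
  rewrite RS_sum_cons Riemann_sum_cons.
  set (u := RS_sum f g s) in *; set (v := Riemann_sum _ s) in *.
  set (x := fst h) in *; set (xi := snd h) in *; set (y := SF_h s) in *.
  replace (minus _ _) with
    (plus (scal (g y - g x - (y - x) * g' xi) (f xi)) (minus u v)).
  + eapply Rle_trans; [apply (norm_triangle (V := V)) |].
    apply Rle_trans with (e * (y - x) * B + B * e * (seq.last y (SF_lx s) - y)).
    * apply Rplus_le_compat; trivial.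
      eapply Rle_trans; [apply (norm_scal (V := V)) |].
      apply Rmult_le_compat; [apply (abs_ge_0 (K := R_AbsRing)) | apply (norm_ge_0 (V := V)) | | apply HB; lra].
      apply Hg; lra.
    * right; change (seq.last y (SF_lx s)) with (seq.last y (seq.unzip1 (SF_t s))).
      ring.
  + rewrite scal_assoc.
    replace (g y - g x - (y - x) * g' xi) with (plus (g y - g x) (opp (mult (y - x) (g' xi))))
      by (unfold plus, opp, mult; simpl; ring).
    rewrite scal_distr_r scal_opp_l /minus opp_plus !plus_assoc; f_equal.
    rewrite -!plus_assoc; f_equal; apply plus_comm.
Qed.

(** By the mean value theorem g y - g x = g'(c) (y - x), and uniform continuity of g' makes g'(c)
    close to g'(xi) on a fine subdivision. The Stieltjes sums thus share the limit of the Riemann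
    sums of g' f. *)
Lemma is_RSInt_C1 {V : NormedModule R_AbsRing} (f : R -> V) (g g' : R -> R) (a b : R) (l : V) :
  a < b -> (forall x, continuous f x) -> (forall x, is_derive g x (g' x)) ->
  (forall x, continuous g' x) ->
  is_RInt (fun x => scal (g' x) (f x)) a b l -> is_RSInt f g a b l.
Proof.
intros Hab Hf Hg Hg' HI.
destruct (bounded_continuity f a b (fun x _ => Hf x)) as [B HB].
pose (D := fun ptd : SF_seq => minus (RS_sum f g ptd) (Riemann_sum (fun x => scal (g' x) (f x)) ptd) : V).
assert (HD : filterlim (D : SF_seq -> V) (Riemann_fine a b) (locally (zero : V))).
{ apply (filterlim_norm_zero (V := V)), filterlim_locally; intros eps.
  assert (B0 : 0 <= B) by (apply Rle_trans with (norm (f a)); [apply norm_ge_0 | left; apply HB; lra]).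
  assert (He : 0 < eps / ((B + 1) * (b - a))).
  { apply Rdiv_lt_0_compat; [apply cond_pos | nra]. }
  destruct (unifcont_1d g' a b (fun x _ => Hg' x) (mkposreal _ He)) as [delta Hdelta].
  (* Halving turns the non-strict mesh bound of [RS_sum_near] into the strict |c - xi| < delta. *)
  assert (Hd : 0 < delta / 2) by (assert (H := cond_pos delta); lra).
  exists (mkposreal _ Hd); intros ptd Hstep (Hp & Hh & Hl); simpl in Hstep.
  rewrite Rmin_left in Hh; [| lra]. rewrite Rmax_right in Hl; [| lra].
  assert (N := RS_sum_near f g g' a b B (eps / ((B + 1) * (b - a))) (delta / 2) (Rlt_le _ _ He)
    (fun x Hx => Rlt_le _ _ (HB x Hx))).
  assert (N' : norm (D ptd) <= B * (eps / ((B + 1) * (b - a))) *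
    (seq.last (SF_h ptd) (SF_lx ptd) - SF_h ptd)).
  { apply N; trivial; try lra.
    intros x xi y Hx Hy Hxy.
    destruct (MVT_gen g x y g') as (c & Hc & E).
    - intros t _; apply Hg.
    - intros t _; apply continuity_pt_filterlim, (ex_derive_continuous g).
      exists (g' t); apply Hg.
    - rewrite Rmin_left in Hc; [| lra]. rewrite Rmax_right in Hc; [| lra].
      rewrite E.
      replace (g' c * (y - x) - (y - x) * g' xi) with ((g' c - g' xi) * (y - x)) by ring.
      rewrite Rabs_mult (Rabs_pos_eq (y - x)); [| lra].
      apply Rmult_le_compat_r; [lra |].
      assert (Hcx : Rabs (c - xi) < delta).
      { assert (H := cond_pos delta); apply Rabs_def1; lra. }
      (* [Hdelta] gives closeness only up to double negation, which suffices in an argument by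
         contradiction. *)
      apply Rnot_lt_le; intros Hlt.
      apply (Hdelta xi c); [lra | lra | exact Hcx |]; intros Hball.
      exact (Rlt_asym _ _ Hlt Hball). }
  rewrite Hl Hh in N'.
  assert (E : B * (eps / ((B + 1) * (b - a))) * (b - a) < eps).
  { replace (B * (eps / ((B + 1) * (b - a))) * (b - a)) with (eps * (B / (B + 1)))
      by (field; lra).
    rewrite -{2}(Rmult_1_r eps); apply Rmult_lt_compat_l; [apply cond_pos |].
    apply (Rmult_lt_reg_r (B + 1)); [lra |].
    replace (B / (B + 1) * (B + 1)) with B by (field; lra). lra. }
  change (Rabs (norm (D ptd) - 0) < eps).
  rewrite Rminus_0_r Rabs_pos_eq; [lra | apply norm_ge_0]. }
unfold is_RSInt; rewrite sign_eq_1; [| lra].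
unfold is_RInt in HI; rewrite sign_eq_1 in HI; [| lra].
apply (filterlim_ext (fun ptd =>
  plus (scal 1 (Riemann_sum (fun x => scal (g' x) (f x)) ptd)) (D ptd))).
- intros ptd; unfold D, minus.
  rewrite (scal_one (V := V)) (scal_one (V := V)).
  rewrite plus_comm -plus_assoc plus_opp_l plus_zero_r; trivial.
- rewrite -(plus_zero_r l).
  exact (filterlim_comp_2 _ _ _ HI HD (filterlim_plus (V := V) l zero)).
Qed.

(** * The monotone function and its Laplace-Stieltjes transform *)

Section Stieltjes.
Variable k : nat -> nat.
Hypothesis Hk2 : forall n, (2 <= k n)%nat.
Hypothesis Hgrow : forall n, (2 * k n <= k (S n))%nat.

(** 52 is twice the common bound 26 of [tau] and its derivative. *)
Definition tilt (x : R) : R := exp x * (1 + / 52 * tau k x).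

Let tilt' (x : R) : R := exp x * (1 + / 52 * (tau k x + Derive (tau k) x)).

Lemma RtoC_tilt x : RtoC (tilt x) = (RtoC (exp x) * (1 + RtoC (/ 52) * RtoC (tau k x)))%C.
Proof. unfold tilt; now rewrite RtoC_mult RtoC_plus RtoC_mult. Qed.

Lemma is_derive_tilt x : is_derive tilt x (tilt' x).
Proof.
assert (D : ex_derive (tau k) x) by exact (tau_smooth k Hk2 Hgrow 1 x).
unfold tilt, tilt'; auto_derive; trivial.
change (Derive (fun x0 : R => tau k x0) x) with (Derive (tau k) x); ring.
Qed.

Lemma continuous_tilt' x : continuous tilt' x.
Proof.
assert (D1 : ex_derive (tau k) x) by exact (tau_smooth k Hk2 Hgrow 1 x).
assert (D2 : ex_derive (Derive (tau k)) x) by exact (tau_smooth k Hk2 Hgrow 2 x).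
apply (ex_derive_continuous tilt').
unfold tilt'; auto_derive; tauto.
Qed.

Lemma tilt_increasing x y : x <= y -> tilt x <= tilt y.
Proof.
intros Hxy.
destruct (MVT_gen tilt x y tilt') as (c & _ & E).
- intros t _; apply is_derive_tilt.
- intros t _; apply continuity_pt_filterlim, (ex_derive_continuous tilt).
  exists (tilt' t); apply is_derive_tilt.
- assert (H : 0 <= tilt' c).
  { assert (B1 := tau_bound k c); assert (B2 := derive_tau_bound k Hk2 Hgrow c).
    apply Rabs_le_between in B1; apply Rabs_le_between in B2.
    apply Rmult_le_pos; [left; apply exp_pos | lra]. }
  assert (0 <= tilt' c * (y - x)) by (apply Rmult_le_pos; lra). lra.
Qed.

Let f (s : C) (x : R) : C := (RtoC (tau k x) * Cexp (- (s * RtoC x)))%C.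

(** Integration by parts moves the derivative onto e^(-sx), and tilt(x) e^(-sx) = e^(-(s-1)x) (1 +
    tau(x) / 52). The first part integrates explicitly, the second is a truncated Laplace integral
    of [tau] at s - 1, and the -1 comes from tilt(0) = 1. *)
Lemma tilt_integral s T : s <> RtoC 1 ->
  is_CInt (fun x => scal (tilt' x) (Cexp (- (s * RtoC x)) : CR)) 0 T
    (RtoC (tilt T) * Cexp (- (s * RtoC T)) - 1
     + s * ((1 - Cexp (- ((s - 1) * RtoC T))) / (s - 1)
            + RtoC (/ 52) * CInt (f (s - 1)%C) 0 T))%C.
Proof.
intros Hs1.
assert (Hs : (s - 1)%C <> RtoC 0).
{ intros H; apply Hs1; replace s with (s - 1 + 1)%C by ring; rewrite H; ring. }
assert (HE : forall z x, continuous (U := CR) (fun t => Cexp (- (z * RtoC t))%C) x).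
{ intros z x; eapply Cder_continuous, Cder_Cexp. }
assert (HT : forall (g : R -> R) x, continuous g x -> continuous (U := CR) (fun t => RtoC (g t)) x).
{ intros g x Hg; apply Ccont_pair; [exact Hg | apply: continuous_const]. }
assert (Hc : forall x, continuous tilt x).
{ intros x; apply (ex_derive_continuous tilt); exists (tilt' x); apply is_derive_tilt. }
assert (I1 : is_CInt (fun x => RtoC (tilt' x) * Cexp (- (s * RtoC x))
    + RtoC (tilt x) * (- s * Cexp (- (s * RtoC x))))%C 0 T
  (RtoC (tilt T) * Cexp (- (s * RtoC T)) - RtoC (tilt 0) * Cexp (- (s * RtoC 0)))%C).
{ apply (is_RInt_derive (V := CR) (fun x => RtoC (tilt x) * Cexp (- (s * RtoC x)))%C).
  - intros x _; apply (Cder_mult (fun x => RtoC (tilt x))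
      (fun x => Cexp (- (s * RtoC x))%C) x (RtoC (tilt' x))); [| apply Cder_Cexp].
    apply (Cder_RtoC tilt), is_derive_tilt.
  - intros x _; apply (continuous_plus (V := CR)); apply Ccont_mult; auto using continuous_tilt'.
    apply Ccont_mult; trivial; apply: continuous_const. }
rewrite Cexp_at_0 in I1.
replace (tilt 0) with 1 in I1.
2: { unfold tilt; rewrite exp_0 tau_zero //; lra. }
assert (I2 : is_CInt (fun x => Cexp (- ((s - 1) * RtoC x)))%C 0 T
  (- / (s - 1) * Cexp (- ((s - 1) * RtoC T)) - - / (s - 1) * Cexp (- ((s - 1) * RtoC 0)))%C).
(* The integrand is rewritten in the shape that [Cder_mult] produces for a constant times an
   exponential. *)
{ apply (is_RInt_ext (V := CR)
    (fun x => 0 * Cexp (- ((s - 1) * RtoC x)) + - / (s - 1) * (- (s - 1) * Cexp (- ((s - 1) * RtoC x))))%C).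
  { intros x _; change (0 * Cexp (- ((s - 1) * x)) + - / (s - 1) * (- (s - 1) * Cexp (- ((s - 1) * x)))
      = Cexp (- ((s - 1) * x)))%C; field; exact Hs. }
  apply (is_RInt_derive (V := CR) (fun x => - / (s - 1) * Cexp (- ((s - 1) * RtoC x)))%C).
  - intros x _; apply Cder_mult; [apply Cder_const | apply Cder_Cexp].
  - intros x _; apply (continuous_plus (V := CR)); apply Ccont_mult; trivial;
    try apply: continuous_const.
    apply Ccont_mult; trivial; apply: continuous_const. }
rewrite Cexp_at_0 in I2.
pose proof (CInt_Cmult _ _ _ (RtoC (/ 52)) _
  (RInt_correct (V := CR) _ _ _ (ex_Laplace_int k Hk2 Hgrow (s - 1)%C 0 T))) as I3.
pose proof (is_RInt_plus (V := CR) _ _ _ _ _ _ I1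
  (CInt_Cmult _ _ _ s _ (is_RInt_plus (V := CR) _ _ _ _ _ _ I2 I3))) as I.
match type of I with is_RInt _ _ _ ?v =>
  replace (RtoC (tilt T) * Cexp (- (s * RtoC T)) - 1
     + s * ((1 - Cexp (- ((s - 1) * RtoC T))) / (s - 1)
            + RtoC (/ 52) * CInt (f (s - 1)%C) 0 T))%C with v
end.
- revert I; apply (is_RInt_ext (V := CR)); intros x _.
  change (RtoC (tilt' x) * Cexp (- (s * x)) + RtoC (tilt x) * (- s * Cexp (- (s * x))) +
    s * (Cexp (- ((s - 1) * x)) + RtoC (/ 52) * (RtoC (tau k x) * Cexp (- ((s - 1) * x)))) =
    scal (tilt' x) (Cexp (- (s * x)) : CR))%C.
  transitivity (RtoC (tilt' x) * Cexp (- (s * x)))%C.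
  + rewrite -Cexp_shift RtoC_tilt; ring.
  + apply injective_projections; simpl; unfold scal; simpl; unfold mult; simpl; ring.
- change (RtoC (tilt T) * Cexp (- (s * T)) - 1 * 1 +
    s * (- / (s - 1) * Cexp (- ((s - 1) * T)) - - / (s - 1) * 1 +
      RtoC (/ 52) * CInt (f (s - 1)%C) 0 T) =
    RtoC (tilt T) * Cexp (- (s * T)) - 1
     + s * ((1 - Cexp (- ((s - 1) * T))) / (s - 1)
            + RtoC (/ 52) * CInt (f (s - 1)%C) 0 T))%C.
  field; exact Hs.
Qed.

(** Let T tend to infinity in [tilt_integral]: the boundary terms decay like e^(-(Re s - 1) T), and
    -1 + s / (s - 1) = 1 / (s - 1). *)
Lemma is_Laplace_Stieltjes_tilt s l : 1 < Re s ->
  is_Cseries (fun n => RtoC (coef n) * bump_weight (k n) (2 ^ n) (wone 0) (s - 1))%C l ->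
  is_Laplace_Stieltjes tilt s (1 / (s - 1) + s * (RtoC (/ 52) * l))%C.
Proof.
intros Hs Hl P [eps HP].
assert (Hr : 0 < Re (s - 1)%C) by (unfold Re in *; simpl; lra).
assert (Hs1 : s <> RtoC 1) by (intros H; rewrite H in Hs; simpl in Hs; lra).
assert (Hs0 : (s - 1)%C <> RtoC 0) by (intros H; rewrite H in Hr; simpl in Hr; lra).
assert (He := cond_pos eps).
(* Bounds the coefficient of the error I - l below; the added 1 keeps it positive. *)
pose (m := Cmod s / 52 + 1).
assert (Hm : 0 < m).
{ assert (H := Cmod_ge_0 s); unfold m; lra. }
destruct (Laplace_tau_limit k Hk2 Hgrow (s - 1)%C l (eps / 2 / m) Hr
  ltac:(apply Rdiv_lt_0_compat; lra) Hl) as [T1 HT1].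
(* Bounds the coefficient of e^(-(s-1)T): the 2 covers |1 + tau / 52| <= 1 + 26 / 52. *)
pose (c := 2 + Cmod (s / (s - 1))%C).
assert (Hc : 0 < c) by (assert (H := Cmod_ge_0 (s / (s - 1))%C); unfold c; lra).
destruct (exp_decay (Re (s - 1)%C) c (eps / 2) Hr Hc) as [T2 HT2]; [lra |].
apply (Filter_prod _ _ _ (fun a => a = 0) (fun T => Rmax 0 (Rmax T1 T2) < T)).
- reflexivity.
- now exists (Rmax 0 (Rmax T1 T2)).
- intros a T -> HT; eexists; split.
  + simpl.
    apply (is_RSInt_C1 (V := C_R_NormedModule) (fun x => Cexp (- (s * RtoC x))%C) tilt tilt').
    * apply Rle_lt_trans with (2 := HT), Rmax_l.
    * intros x; eapply (Cder_continuous (fun t => Cexp (- (s * RtoC t))%C)), Cder_Cexp.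
    * apply is_derive_tilt.
    * apply continuous_tilt'.
    * exact (tilt_integral s T Hs1).
  + apply HP, C_NormedModule_mixin_compat1.
    assert (K : T1 < T /\ T2 < T).
    { split; apply Rle_lt_trans with (2 := HT);
      (eapply Rle_trans; [| apply Rmax_r]); [apply Rmax_l | apply Rmax_r]. }
    destruct K as [K1 K2]; specialize (HT1 T K1); specialize (HT2 T K2).
    set (I := CInt _ 0 T) in *; set (e := Cexp (- ((s - 1) * RtoC T))%C).
    assert (Ee : Cmod e = exp (- (Re (s - 1)%C * T))).
    { unfold e; rewrite Cmod_Cexp; f_equal; simpl; unfold Re; simpl; ring. }
    match goal with |- Cmod ?u < _ => replace u with
      ((1 + RtoC (/ 52) * RtoC (tau k T)) * e - s / (s - 1) * e + s * RtoC (/ 52) * (I - l))%C end.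
    * eapply Rle_lt_trans; [apply Cmod_triangle |].
      apply Rlt_le_trans with (eps / 2 + eps / 2); [| lra].
      apply Rplus_lt_le_compat.
      -- apply Rle_lt_trans with (2 := HT2); rewrite -Ee.
         eapply Rle_trans; [apply Cmod_triangle |].
         rewrite Cmod_opp !Cmod_mult /c Rmult_plus_distr_r -(Cmod_mult s).
         apply Rplus_le_compat_r, Rmult_le_compat_r; [apply Cmod_ge_0 |].
         eapply Rle_trans; [apply Cmod_triangle |].
         rewrite Cmod_1 -RtoC_mult Cmod_R.
         assert (B := tau_bound k T).
         rewrite Rabs_mult (Rabs_pos_eq (/ 52)); lra.
      -- rewrite !Cmod_mult Cmod_R (Rabs_pos_eq (/ 52)); [| lra].
         apply Rle_trans with (m * (eps / 2 / m)).
         ++ apply Rmult_le_compat; [| apply Cmod_ge_0 | unfold m; lra | lra].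
            assert (H := Cmod_ge_0 s); lra.
         ++ right; field; lra.
    * assert (E : (RtoC (tilt T) * Cexp (- (s * RtoC T)) = (1 + RtoC (/ 52) * RtoC (tau k T)) * e)%C).
      { unfold e; rewrite -Cexp_shift RtoC_tilt; ring. }
      rewrite E; fold e.
      change (((1 + RtoC (/ 52) * RtoC (tau k T)) * e - s / (s - 1) * e
       + s * RtoC (/ 52) * (I - l)) =
       ((1 + RtoC (/ 52) * RtoC (tau k T)) * e - 1 + s * ((1 - e) / (s - 1) + RtoC (/ 52) * I))
       - (1 / (s - 1) + s * (RtoC (/ 52) * l)))%C.
      field; exact Hs0.
Qed.
End Stieltjes.

(** With r the remainder of G, the remainder of the product is z c r + h c (h D + r). Both parts are
    O(|h|^2), as |h| <= 1 gives |h| |r| <= |r|. *)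
Lemma quadratically_approx_shift_mult (G : C -> C) (c z : C) :
  quadratically_approx G (z - 1)%C ->
  quadratically_approx (fun s => s * (c * G (s - 1)))%C z.
Proof.
intros (D & M & HM).
exists (c * G (z - 1) + z * c * D)%C, (Cmod (z * c)%C * M + Cmod c * (Cmod D + M)).
intros h Hh; specialize (HM h Hh).
replace (z + h - 1)%C with (z - 1 + h)%C by ring.
set (r := (G (z - 1 + h) - G (z - 1) - h * D)%C) in *.
replace ((z + h) * (c * G (z - 1 + h)) - z * (c * G (z - 1)) - h * (c * G (z - 1) + z * c * D))%C
  with (z * c * r + h * c * (h * D + r))%C by (unfold r; ring).
assert (T := Cmod_triangle (h * D)%C r); rewrite Cmod_mult in T.
eapply Rle_trans; [apply Cmod_triangle |].
rewrite (Cmod_mult (z * c)%C) (Cmod_mult (h * c)%C) (Cmod_mult h).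
assert (A1 := Cmod_ge_0 (z * c)%C); assert (A2 := Cmod_ge_0 c); assert (A3 := Cmod_ge_0 h).
assert (A4 := Cmod_ge_0 r); assert (A5 := Cmod_ge_0 D).
assert (E1 : Cmod (z * c)%C * Cmod r <= Cmod (z * c)%C * (M * Cmod h ^ 2))
  by now apply Rmult_le_compat_l.
assert (E2 : Cmod h * Cmod r <= M * Cmod h ^ 2) by nra.
assert (E3 : Cmod h * Cmod (h * D + r)%C <= (Cmod D + M) * Cmod h ^ 2) by nra.
assert (E4 : Cmod c * (Cmod h * Cmod (h * D + r)%C) <= Cmod c * ((Cmod D + M) * Cmod h ^ 2))
  by now apply Rmult_le_compat_l.
lra.
Qed.

(** Each k (n + 1) is the maximum of 2 k n, which keeps the supports disjoint, and of a threshold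
    beyond which rho is below the height of the next bump. *)
Lemma exists_sparse_sequence (rho : R -> R) : is_lim rho p_infty 0 ->
  exists k : nat -> nat, (forall n, (2 <= k n)%nat) /\ (forall n, (2 * k n <= k (S n))%nat) /\
    forall n x, INR (k n) <= x -> rho x < (1 / 4) ^ n / 2.
Proof.
intros Hrho.
assert (H : forall n, exists K : nat, forall x, INR K <= x -> rho x < (1 / 4) ^ n / 2).
{ intros n.
  assert (He : 0 < (1 / 4) ^ n / 2).
  { assert (0 < (1 / 4) ^ n) by (apply pow_lt; lra); lra. }
  apply is_lim_spec in Hrho; destruct (Hrho (mkposreal _ He)) as [M HM]; simpl in HM.
  destruct (INR_unbounded M) as [K HK]; exists K; intros x Hx.
  assert (L := HM x ltac:(lra)); apply Rabs_def2 in L; lra. }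
destruct (functional_choice _ H) as [K HK].
pose (k := fix k n := match n with
  | O => Nat.max 2 (K 0%nat) | S m => Nat.max (2 * k m) (K (S m)) end).
exists k; split; [| split].
- induction n as [|n IH]; [exact (Nat.le_max_l 2 (K 0%nat)) |].
  assert (Hn : (2 * k n <= k (S n))%nat) by apply Nat.le_max_l; lia.
- intros n; apply Nat.le_max_l.
- intros n x Hx; apply HK, Rle_trans with (2 := Hx), le_INR.
  destruct n; apply Nat.le_max_r.
Qed.

Theorem theorem1 (rho : R -> R)
  (rho_pos : forall x : R, 0 < x -> 0 < rho x)
  (rho_lim : is_lim rho p_infty 0) :
  (exists (S : R -> R) (L : C -> C),
     (forall x y : R, 0 <= x -> x <= y -> S x <= S y) /\
     (forall s : C, 1 < Re s -> is_Laplace_Stieltjes S s (L s)) /\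
     extends_entire (fun s => 1 < Re s)
       (fun s => (L s - RtoC 1 / (s - RtoC 1))%C) /\
     Omega_pm (fun x => S x - exp x) (fun x => rho x * exp x))
  /\
  (exists (tau : R -> R) (L : C -> C),
     (forall (n : nat) (x : R), 0 < x -> ex_derive_n tau n x) /\
     (exists M : R, forall x : R, 0 < x -> Rabs (Derive tau x) <= M) /\
     (forall s : C, 0 < Re s -> is_Laplace tau s (L s)) /\
     extends_entire (fun s => 0 < Re s) L /\
     Omega_pm tau rho).
Proof.
destruct (exists_sparse_sequence rho rho_lim) as (k & Hk2 & Hgrow & Hrho).
assert (Hkn := k_ge k Hk2 Hgrow).
destruct (bump_series_entire k coef Hk2 Hkn) as (G & HG & HGs).
{ intros n; rewrite Rabs_coef pow_quarter.
  assert (H := half_pow_bounds n); nra. }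
assert (HO := tau_oscillates k Hk2 Hgrow rho Hrho).
split.
- exists (tilt k), (fun s => 1 / (s - 1) + s * (RtoC (/ 52) * G (s - 1)))%C.
  split; [| split; [| split]].
  + intros x y _; now apply tilt_increasing.
  + intros s Hs; now apply is_Laplace_Stieltjes_tilt.
  (* Subtracting 1 / (s - 1) from the transform leaves exactly this function, defined and entire on
     all of C. *)
  + exists (fun s => s * (RtoC (/ 52) * G (s - 1)))%C; split;
    [intros z; now apply quadratically_approx_ex_derive, quadratically_approx_shift_mult |].
    intros s _; ring.
  (* The deviation from e^x is e^x tau(x) / 52, so the constant for [tau] is divided by 52. *)
  + destruct HO as (c & Hc & H1 & H2).
    assert (E : forall x, tilt k x - exp x = / 52 * (exp x * tau k x)) by (intros x; unfold tilt; ring).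
    exists (/ 52 * c); split; [lra |]; split; intros X.
    * destruct (H1 X) as (x & Hx & H); exists x; split; trivial.
      rewrite E; assert (P := exp_pos x); nra.
    * destruct (H2 X) as (x & Hx & H); exists x; split; trivial.
      rewrite E; assert (P := exp_pos x); nra.
- exists (tau k), G; split; [| split; [| split; [| split]]]; trivial.
  + intros n x _; now apply tau_smooth.
  + exists 26; intros x _; now apply derive_tau_bound.
  + intros s Hs; now apply is_Laplace_tau.
  + exists G; split; trivial.
    intros z; now apply quadratically_approx_ex_derive.
Qed.
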